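(* Let $r$ be a nonconstant symmetric rational function, let $Q_0\in\mathcal N_0^0(r)$ (i.e. $Q_0\in\mathcal N$ and $rQ_0\in\mathcal N$), and let $a_i\in\mathbb R\cup\{\infty\}$, $1\le i\le n_1$, and $b_i\in\mathbb R\cup\{\infty\}$, $1\le i\le n_2$, be some sets of zeros and poles of $r$, respectively. Then $$Q_0\in\bigcap_{i=1}^{n_2}\mathcal N(b_i,1)\qquad\text{and}\qquad rQ_0\in\bigcap_{i=1}^{n_1}\mathcal N(a_i,1).$$
   Context: A function $f$ is symmetric if $f(\bar z)=\overline{f(z)}$. $\mathcal N$ is the class of Nevanlinna functions: symmetric functions $Q$ holomorphic on $\mathbb C\setminus\mathbb R$ with $\operatorname{Im}Q(z)/\operatorname{Im}z\ge0$ there. $\mathcal N_0^0(r)=\{Q\in\mathcal N:\ rQ\in\mathcal N\}$. Kac–Donoghue classes: $Q\in\mathcal N$ belongs to $\mathcal N(\infty,1)$ if $\int_1^\infty\frac{\operatorname{Im}Q(iy)}{y}\,dy<\infty$, and to $\mathcal N(\xi,1)$, $\xi\in\mathbb R$, if $\int_0^1\frac{\operatorname{Im}Q(\xi+iy)}{y}\,dy<\infty$. *)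

(* Defs.v *)
From mathcomp Require Import all_boot all_order all_algebra.
From mathcomp Require Import complex.
From mathcomp Require Import all_classical all_reals all_analysis.

Set Implicit Arguments.
Unset Strict Implicit.
Unset Printing Implicit Defensive.

Import Order.TTheory GRing.Theory Num.Theory.
Import numFieldNormedType.Exports.

Local Open Scope classical_set_scope.
Local Open Scope ring_scope.
Local Open Scope complex_scope.

(* A function on a subset D of the complex plane is represented by a total
   function R[i] -> R[i]; its values outside D are irrelevant. *)

Definition symmetric_on (R : realType) (D : set R[i]) (f : R[i] -> R[i]) : Prop :=
  forall z, D z -> D z^* /\ f z^* = (f z)^*.

Definition nonreal (R : realType) : set R[i] := [set z | complex.Im z != 0].

(* [derivable _ z 1] is taken over the normed field R[i], i.e. it is complex
   differentiability at z. *)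
Definition holomorphic_on (R : realType) (D : set R[i]) (f : R[i] -> R[i]) : Prop :=
  forall z, D z -> derivable (f : R[i]^o -> R[i]^o) z 1.

Definition nevanlinna (R : realType) : set (R[i] -> R[i]) :=
  [set Q | [/\ symmetric_on (@nonreal R) Q,
               holomorphic_on (@nonreal R) Q &
               forall z, nonreal z -> 0 <= complex.Im (Q z) / complex.Im z]].

(* Rational functions, in lowest terms. *)
Record ratfun (R : realType) := Ratfun {
  ratfun_num : {poly R[i]};
  ratfun_den : {poly R[i]};
  ratfun_den_neq0 : ratfun_den != 0;
  ratfun_coprime : coprimep ratfun_num ratfun_den
}.

(* Finite poles; [ratfun_eval r z] is the value of r at z only if z is not one
   of them. *)
Definition finite_pole (R : realType) (r : ratfun R) (z : R[i]) : bool :=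
  root (ratfun_den r) z.

Definition ratfun_eval (R : realType) (r : ratfun R) (z : R[i]) : R[i] :=
  (ratfun_num r).[z] / (ratfun_den r).[z].

Definition ratfun_symmetric (R : realType) (r : ratfun R) : Prop :=
  symmetric_on [set z | ~~ finite_pole r z] (ratfun_eval r).

Definition ratfun_nonconstant (R : realType) (r : ratfun R) : Prop :=
  ~ exists c : R[i], forall z, ~~ finite_pole r z -> ratfun_eval r z = c.

(* R together with the point oo is [option R], with [None] for oo. *)
Definition ratfun_zero (R : realType) (r : ratfun R) (a : option R) : Prop :=
  match a with
  | Some x => root (ratfun_num r) x%:C
  | None => (size (ratfun_num r) < size (ratfun_den r))%N
  end.

Definition ratfun_pole (R : realType) (r : ratfun R) (b : option R) : Prop :=
  match b with
  | Some x => finite_pole r x%:C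
  | None => (size (ratfun_den r) < size (ratfun_num r))%N
  end.

(* [mul_in r Q K]: the product r * Q, a meromorphic function on the nonreal
   numbers, belongs to the class K.  As r may have nonreal poles, this product
   is only given pointwise off these poles; it belongs to K when it has an
   extension S in K to all nonreal numbers.  Within the Nevanlinna functions
   S is unique on the nonreal numbers, by continuity. *)
Definition mul_in (R : realType) (r : ratfun R) (Q : R[i] -> R[i])
    (K : set (R[i] -> R[i])) : Prop :=
  exists2 S, K S &
    forall z, nonreal z -> ~~ finite_pole r z -> S z = ratfun_eval r z * Q z.

Definition nevanlinna00 (R : realType) (r : ratfun R) : set (R[i] -> R[i]) :=
  [set Q | nevanlinna Q /\ mul_in r Q (@nevanlinna R)].

Definition kac_donoghue (R : realType) (xi : option R) : set (R[i] -> R[i]) :=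
  [set Q | nevanlinna Q /\
    match xi with
    | Some x => (\int[@lebesgue_measure R]_(y in `]0%R, 1%R])
                   (complex.Im (Q (x +i* y)) / y)%:E < +oo)%E
    | None => (\int[@lebesgue_measure R]_(y in `[1%R, +oo[)
                 (complex.Im (Q (0 +i* y)) / y)%:E < +oo)%E
    end].

(* Main.v *)
Require Import Defs.
From mathcomp Require Import all_boot all_order all_algebra.
From mathcomp Require Import complex ring lra zify.
From mathcomp Require Import all_classical all_reals all_analysis.
From mathcomp Require Import measurable_realfun.

Set Implicit Arguments.
Unset Strict Implicit.
Unset Printing Implicit Defensive.

Import Order.TTheory GRing.Theory Num.Theory.
Import numFieldNormedType.Exports.

Local Open Scope classical_set_scope.
Local Open Scope ring_scope.

(** Write [S] for the Nevanlinna extension of [r * Q]. The relation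
[q * S = p * Q], with [r = p / q], is symmetric in the pairs [(p, Q)] and
[(q, S)], so the claim on the zeros of [r] is the claim on the poles of [1 / r].
A finite pole is moved to [0] by a translation and the pole at infinity by
[z |-> - 1 / z]; both maps preserve the upper half-plane. It remains to show
([pole_bounded]): if [z ^+ m * S z = k z * Q z] near [0], with [0 < m] and [k]
Lipschitz, symmetric and nonzero at [0], then the integrals of
[s |-> Im (Q (i e^s))] over [[s1, 0]] are bounded uniformly in [s1 <= 0].

No integral representation is used. The Schwarz-Pick inequality
[y |S'(i y)| <= Im (S (i y))] says that [y * Im (S (i y))] is nondecreasing and
gives [|S (i y)| <= C / y] for small [y] ([pick_growth]), hence
[|Q (i y)| <= C y ^ (m - 1)]. For [m >= 2] the bound on the integrals is
immediate.

For [m = 1], the reflection [z |-> - conj z] reduces to [k 0 < 0]. Up to a small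
error, the argument of [k z / z] is then [pi - arg z]. As [Q z] and
[(k z / z) * Q z] both lie in the closed upper half-plane, this forces
[arg (Q z) <= arg z] ([simple_pole_sector]). Therefore [P = - 1 / (Q + 1)] is
bounded by [2] on the part of the first quadrant near [0], and [Im P] is small
on rays of small angle. Cauchy's theorem for [P (exp (s + i t))] on the
rectangle [[s1, s0] x [e, pi / 2]] equates the integral of [Im P] along the top
side to its integral along the bottom side, which tends to [0] with [e], plus
the integrals of [Re P] along the two vertical sides, which are bounded
whatever [s1] is. So the integral of [Im (P (i e^s))] is bounded, and
[Im Q = |Q + 1| ^ 2 * Im P] with [Q] bounded on the imaginary axis
([simple_pole_bounded_lt0]).

Cauchy's theorem is needed for functions that are only assumed to be complex
differentiable, and is proved by bisection of rectangles ([goursat]), as a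
statement on two real functions. In logarithmic coordinates it also gives the
mean value property over circles ([circle_mean]), from which the Schwarz-Pick
inequality follows. *)

(** * Integrals of continuous functions over segments *)

Definition segint (R : realType) (f : R -> R) (a b : R) : R :=
  \int[@lebesgue_measure R]_(x in `[a, b]) f x.

Definition seg_continuous (R : realType) (f : R -> R) (a b : R) :=
  forall x, a <= x <= b -> {for x, continuous f}.

Section Segint.
Variable R : realType.
Implicit Types (f g : R -> R) (a b m : R).

Lemma seg_within f a b : seg_continuous f a b -> {within `[a, b], continuous f}.
Proof.
move=> h; apply: continuous_in_subspaceT => x.
by rewrite inE /= in_itv /= => /h.
Qed.

Lemma seg_integrable f a b : seg_continuous f a b ->
  (@lebesgue_measure R).-integrable `[a, b] (EFin \o f).
Proof.
move=> /seg_within h; apply: continuous_compact_integrable => //.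
exact: segment_compact.
Qed.

Lemma seg_sub f a b a' b' : a <= a' -> b' <= b ->
  seg_continuous f a b -> seg_continuous f a' b'.
Proof.
move=> h1 h2 h x /andP[x1 x2]; apply: h.
by rewrite (le_trans h1 x1) (le_trans x2 h2).
Qed.

Lemma segcB f g a b : seg_continuous f a b -> seg_continuous g a b ->
  seg_continuous (fun x => f x - g x) a b.
Proof. by move=> hf hg x hx; apply: continuousB; [exact: hf|exact: hg]. Qed.

Lemma segcZ k f a b : seg_continuous f a b ->
  seg_continuous (fun x => k * f x) a b.
Proof. by move=> hf x hx; apply: continuousM; [exact: cvg_cst|exact: hf]. Qed.

Lemma segintB f g a b : seg_continuous f a b -> seg_continuous g a b ->
  segint (fun x => f x - g x) a b = segint f a b - segint g a b.
Proof.
by move=> hf hg; rewrite /segint RintegralB //; exact: seg_integrable.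
Qed.

Lemma segintZ k f a b : seg_continuous f a b ->
  segint (fun x => k * f x) a b = k * segint f a b.
Proof.
by move=> hf; rewrite /segint RintegralZl //; exact: seg_integrable.
Qed.

Lemma segint_cst k a b : a <= b -> segint (fun=> k) a b = k * (b - a).
Proof.
move=> ab; rewrite /segint Rintegral_cst //.
have /= := lebesgue_measure_itv `[a, b]; rewrite lte_fin => ->.
by case: ltP => //= ba; rewrite (@le_anti _ _ a b) ?ab// subrr.
Qed.

Lemma segint_split m f a b : a <= m <= b -> seg_continuous f a b ->
  segint f a b = segint f a m + segint f m b.
Proof.
move=> /andP[am mb] hf; rewrite /segint.
have hi := seg_integrable hf.
have := @Rintegral_itvB R f (BLeft a) (BRight b) m hi.
rewrite !bnd_simp => /(_ am mb) h.
rewrite -(@Rintegral_itv_obnd_cbnd R m); first by rewrite -h addrC subrK.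
apply: integrableS hi => //; apply: subset_itvr.
by rewrite bnd_simp.
Qed.

Lemma le_segint f g a b : seg_continuous f a b -> seg_continuous g a b ->
  (forall x, a <= x <= b -> f x <= g x) -> segint f a b <= segint g a b.
Proof.
move=> hf hg h; apply: le_Rintegral => //; try exact: seg_integrable.
Qed.

Lemma segc_cst k a b : seg_continuous (fun=> k : R) a b.
Proof. by move=> x _; exact: cvg_cst. Qed.

Lemma segint_near_cst k e f a b : a <= b -> seg_continuous f a b ->
  (forall x, a <= x <= b -> `|f x - k| <= e) ->
  `|segint f a b - k * (b - a)| <= e * (b - a).
Proof.
move=> ab hf h.
have H1 : segint f a b <= segint (fun=> k + e) a b.
  apply: le_segint => //; first exact: segc_cst.
  by move=> x /h; rewrite ler_norml => /andP[_]; rewrite lerBlDl.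
have H2 : segint (fun=> k - e) a b <= segint f a b.
  apply: le_segint => //; first exact: segc_cst.
  by move=> x /h; rewrite ler_norml => /andP[+ _]; rewrite lerBrDl.
move: H1 H2; rewrite !segint_cst // => H1 H2.
by rewrite ler_norml; apply/andP; split; lra.
Qed.

Lemma eq_segint f g a b : (forall x, a <= x <= b -> f x = g x) ->
  segint f a b = segint g a b.
Proof.
by move=> h; apply: eq_Rintegral => x; rewrite inE /= in_itv /= => /h.
Qed.

End Segint.

(** * Cauchy's theorem for rectangles *)

(** Complex differentiability of [U + i V] at [s + i t], the derivative being
[A + i B]. *)
Definition CRat (R : realType) (U V : R -> R -> R) (s t : R) : Prop :=
  exists A B : R, forall e : R, 0 < e -> exists2 d : R, 0 < d &
    forall s' t', `|s' - s| < d -> `|t' - t| < d ->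
     `|U s' t' - U s t - A * (s' - s) + B * (t' - t)| <= e * (`|s' - s| + `|t' - t|)
     /\
     `|V s' t' - V s t - B * (s' - s) - A * (t' - t)| <= e * (`|s' - s| + `|t' - t|).

Section Goursat.
Variable R : realType.
Implicit Types (U V : R -> R -> R) (a b c d s t : R).

(** Multiplication by [- i], which exchanges real and imaginary parts. *)
Lemma CRat_rot U V s t : CRat U V s t -> CRat V (fun s t => - U s t) s t.
Proof.
move=> [A [B h]]; exists B, (- A) => e e0.
have [d d0 {}h] := h e e0; exists d => // s' t' hs ht.
have [h1 h2] := h s' t' hs ht; split; first by move: h2; congr (`|_| <= _); ring.
by rewrite -normrN; move: h1; congr (`|_| <= _); ring.
Qed.

Lemma lip_continuous (f : R -> R) x K d : 0 < d ->
  (forall y, `|y - x| < d -> `|f y - f x| <= K * `|y - x|) ->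
  {for x, continuous f}.
Proof.
move=> d0 h; apply/cvgrPdist_le => e e0.
have K0 : 0 < `|K| + 1 by rewrite ltr_wpDl.
have m0 : 0 < Num.min d (e / (`|K| + 1)) by rewrite lt_min d0 divr_gt0.
apply/nbhs_ballP; exists (Num.min d (e / (`|K| + 1))) => //= y.
rewrite /ball /= lt_min distrC => /andP[y1 y2].
rewrite distrC; apply: le_trans (h y y1) _.
rewrite ltr_pdivlMr // in y2; apply: le_trans (ltW y2).
rewrite mulrC; apply: ler_wpM2l => //.
by rewrite (le_trans (ler_norm _)) // lerDl.
Qed.

Lemma CRat_cont U V s t : CRat U V s t ->
  [/\ {for s, continuous (U ^~ t)}, {for s, continuous (V ^~ t)},
      {for t, continuous (U s)} & {for t, continuous (V s)}].
Proof.
move=> [A [B h]]; have [d d0 {}h] := h 1 ltr01.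
have L (u v k : R) : `|u - k * v| <= 1 * `|v| -> `|u| <= (`|k| + 1) * `|v|.
  move=> le1; rewrite -(subrK (k * v) u); apply: le_trans (ler_normD _ _) _.
  by rewrite addrC mulrDl normrM lerD2l.
have s0 : `|s - s| < d by rewrite subrr normr0.
have t0 : `|t - t| < d by rewrite subrr normr0.
split; apply: (@lip_continuous _ _ _ d) => // y hy.
- apply: (L _ _ A); have [h1 _] := h y t hy t0.
  by move: h1; rewrite subrr normr0 addr0 mulr0 addr0.
- apply: (L _ _ B); have [_ h1] := h y t hy t0.
  by move: h1; rewrite subrr normr0 addr0 mulr0 subr0.
- apply: (L _ _ (- B)); have [h1 _] := h s y s0 hy.
  by move: h1; rewrite subrr normr0 add0r mulr0 subr0 mulNr opprK.
- apply: (L _ _ A); have [_ h1] := h s y s0 hy.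
  by move: h1; rewrite subrr normr0 add0r mulr0 subr0.
Qed.

Lemma nested_point (a b : nat -> R) :
  (forall n, a n <= a n.+1) -> (forall n, b n.+1 <= b n) ->
  (forall n, a n <= b n) -> exists p, forall n, a n <= p <= b n.
Proof.
move=> ha hb hab.
have am m n : (m <= n)%N -> a m <= a n.
  move=> /subnK <-; elim: (n - m)%N => [|k IH]; rewrite ?addSn ?add0n //; exact: le_trans IH (ha _).
have bm m n : (m <= n)%N -> b n <= b m.
  by move=> /subnK <-; elim: (n - m)%N => [|k IH]; rewrite ?addSn ?add0n //; exact: le_trans (hb _) IH.
have ab m n : a m <= b n.
  apply: le_trans (am _ _ (leq_maxl m n)) _.
  exact: le_trans (hab _) (bm _ _ (leq_maxr m n)).
exists (sup (range a)) => n; apply/andP; split.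
  apply: ub_le_sup; last by exists n.
  by exists (b 0%N) => _ [m _ <-].
apply: ge_sup; first by exists (a 0%N); exists 0%N.
by move=> _ [m _ <-].
Qed.

(** The real part of the integral of [U + i V] along the boundary of
[[a, b] x [c, d]]. *)
Definition rect_loop U V a b c d : R :=
  segint (fun s => U s c - U s d) a b - segint (fun t => V b t - V a t) c d.

Definition rectCR U V a b c d :=
  forall s t, a <= s <= b -> c <= t <= d -> CRat U V s t.

Lemma rectCR_sub U V a b c d a' b' c' d' :
  a <= a' -> b' <= b -> c <= c' -> d' <= d ->
  rectCR U V a b c d -> rectCR U V a' b' c' d'.
Proof.
move=> h1 h2 h3 h4 h s t /andP[s1 s2] /andP[t1 t2]; apply: h; lra.
Qed.

Lemma rect_loop_splitl m U V a b c d : a <= m <= b -> c <= d ->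
  rectCR U V a b c d ->
  rect_loop U V a b c d = rect_loop U V a m c d + rect_loop U V m b c d.
Proof.
move=> /andP[am mb] cd h; rewrite /rect_loop.
have cU t : c <= t <= d -> seg_continuous (U ^~ t) a b.
  by move=> ht s hs; have [] := CRat_cont (h s t hs ht).
have cV s : a <= s <= b -> seg_continuous (V s) c d.
  by move=> hs t ht; have [] := CRat_cont (h s t hs ht).
have ab := le_trans am mb.
rewrite (@segint_split _ m) ?am //; last by apply: segcB; apply: cU; lra.
rewrite !segintB; try (by apply: cV; lra); try (by apply: (@seg_sub _ _ a b) => //; apply: cU; lra).
ring.
Qed.

Lemma rect_loop_splitr m U V a b c d : a <= b -> c <= m <= d ->
  rectCR U V a b c d ->
  rect_loop U V a b c d = rect_loop U V a b c m + rect_loop U V a b m d.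
Proof.
move=> ab /andP[cm md] h; rewrite /rect_loop.
have cU t : c <= t <= d -> seg_continuous (U ^~ t) a b.
  by move=> ht s hs; have [] := CRat_cont (h s t hs ht).
have cV s : a <= s <= b -> seg_continuous (V s) c d.
  by move=> hs t ht; have [] := CRat_cont (h s t hs ht).
have cd := le_trans cm md.
rewrite (@segint_split _ m _ c d) ?cm //; last by apply: segcB; apply: cV; lra.
rewrite !segintB; try (by apply: cU; lra); try (by apply: (@seg_sub _ _ c d) => //; apply: cV; lra).
ring.
Qed.

(** The integral along the boundary vanishes for an affine function. What remains is
the error of the affine approximation, at most [e] times the diameter, integrated
along the perimeter. *)
Lemma rect_loop_local U V s t e : 0 < e -> CRat U V s t ->
  exists2 r, 0 < r & forall a b c d, a <= s <= b -> c <= t <= d ->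
    b - a < r -> d - c < r -> rectCR U V a b c d ->
    `|rect_loop U V a b c d| <= e * ((b - a) + (d - c)) ^+ 2.
Proof.
move=> e0 [A [B h]]; have [|r r0 {}h] := h (e / 2); first by rewrite divr_gt0.
exists r => // a b c d /andP[as_ sb] /andP[ct td] bar dcr H.
have ab := le_trans as_ sb; have cd := le_trans ct td.
have cU t' : c <= t' <= d -> seg_continuous (U ^~ t') a b.
  by move=> ht s' hs; have [] := CRat_cont (H s' t' hs ht).
have cV s' : a <= s' <= b -> seg_continuous (V s') c d.
  by move=> hs t' ht; have [] := CRat_cont (H s' t' hs ht).
set l := b - a in bar *; set k := d - c in dcr *.
have K s' t' : a <= s' <= b -> c <= t' <= d ->
  `|s' - s| < r /\ `|t' - t| < r /\ e / 2 * (`|s' - s| + `|t' - t|) <= e / 2 * (l + k).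
  move=> hs ht.
  have h1 : `|s' - s| <= l by rewrite ler_norml /l; lra.
  have h2 : `|t' - t| <= k by rewrite ler_norml /k; lra.
  split; first exact: le_lt_trans h1 _.
  split; first exact: le_lt_trans h2 _.
  by apply: ler_wpM2l; [rewrite ltW // divr_gt0|exact: lerD].
have TR (x y z : R) : x = y - z -> `|y| <= e / 2 * (l + k) -> `|z| <= e / 2 * (l + k) ->
  `|x| <= e * (l + k).
  move=> -> h1 h2; apply: le_trans (ler_normB _ _) _.
  by move: h1 h2; lra.
have I1 : `|segint (fun s => U s c - U s d) a b - B * k * l| <= e * (l + k) * l.
  apply: segint_near_cst => //; first by apply: segcB; apply: cU; lra.
  move=> x hx.
  have [|p1 [p2 p3]] := K x c hx; [by lra|].
  have [|q1 [q2 q3]] := K x d hx; [by lra|].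
  have [m1 _] := h _ _ p1 p2; have [m2 _] := h _ _ q1 q2.
  apply: (TR _ _ _ _ (le_trans m1 p3) (le_trans m2 q3)).
  rewrite /k; ring.
have I2 : `|segint (fun t => V b t - V a t) c d - B * l * k| <= e * (l + k) * k.
  apply: segint_near_cst => //; first by apply: segcB; apply: cV; lra.
  move=> x hx.
  have [||p1 [p2 p3]] := K b x; [by lra..|].
  have [||q1 [q2 q3]] := K a x; [by lra..|].
  have [_ m1] := h _ _ p1 p2; have [_ m2] := h _ _ q1 q2.
  apply: (TR _ _ _ _ (le_trans m1 p3) (le_trans m2 q3)).
  rewrite /l; ring.
rewrite /rect_loop.
set X := segint _ _ _ in I1 *; set Y := segint _ _ _ in I2 *.
rewrite (_ : X - Y = (X - B * k * l) - (Y - B * l * k)); last by ring.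
apply: le_trans (ler_normB _ _) _.
apply: le_trans (lerD I1 I2) _.
rewrite le_eqVlt; apply/orP; left; apply/eqP; ring.
Qed.

(** If the bound fails on a rectangle, it fails on one of its quarters, as the square
of the perimeter is divided by four. Repeated quartering then gives nested
rectangles on which the bound fails, shrinking to a point, in contradiction with
[rect_loop_local]. *)
Lemma rect_loop_small U V a b c d e : 0 < e -> a <= b -> c <= d ->
  rectCR U V a b c d ->
  `|rect_loop U V a b c d| <= e * ((b - a) + (d - c)) ^+ 2.
Proof.
move=> e0 ab cd H.
pose bad (q : R * R * nat) :=
  let l := (b - a) / 2 ^+ q.2 in let k := (d - c) / 2 ^+ q.2 in
  [/\ a <= q.1.1, q.1.1 + l <= b, c <= q.1.2, q.1.2 + k <= d &
  e * (l + k) ^+ 2 < `|rect_loop U V q.1.1 (q.1.1 + l) q.1.2 (q.1.2 + k)|].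
have [//|gt] := leP; exfalso.
have bad0 : bad (a, c, 0%N).
  rewrite /bad /= expr0 !divr1 (addrC a) (addrC c) !subrK.
  by split; [exact: lexx..|exact: gt].
pose child (q q' : R * R * nat) := [/\ q'.2 = q.2.+1,
   q.1.1 <= q'.1.1, q'.1.1 + (b - a) / 2 ^+ q'.2 <= q.1.1 + (b - a) / 2 ^+ q.2,
   q.1.2 <= q'.1.2 & q'.1.2 + (d - c) / 2 ^+ q'.2 <= q.1.2 + (d - c) / 2 ^+ q.2].
have step q : bad q -> exists q', bad q' /\ child q q'.
  move: q => [[x y] n] [/=].
  move El0: ((b - a) / 2 ^+ n) => l; move Ek0: ((d - c) / 2 ^+ n) => k x1 x2 y1 y2 G.
  have l0 : 0 <= l by rewrite -El0 divr_ge0 ?exprn_ge0 // subr_ge0.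
  have k0 : 0 <= k by rewrite -Ek0 divr_ge0 ?exprn_ge0 // subr_ge0.
  have El : (b - a) / 2 ^+ n.+1 = l / 2 by rewrite -El0 exprS invfM mulrCA mulrC.
  have Ek : (d - c) / 2 ^+ n.+1 = k / 2 by rewrite -Ek0 exprS invfM mulrCA mulrC.
  have H' : rectCR U V x (x + l) y (y + k) by apply: rectCR_sub H => //.
  have E : rect_loop U V x (x + l) y (y + k) =
     rect_loop U V x (x + l / 2) y (y + k / 2)
   + rect_loop U V x (x + l / 2) (y + k / 2) (y + k / 2 + k / 2)
   + (rect_loop U V (x + l / 2) (x + l / 2 + l / 2) y (y + k / 2)
   + rect_loop U V (x + l / 2) (x + l / 2 + l / 2) (y + k / 2) (y + k / 2 + k / 2)).
    rewrite (@rect_loop_splitl (x + l / 2)) //; [|clear -l0 k0; lra..].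
    rewrite -!(addrA x) -!(addrA y) -!splitr.
    congr (_ + _).
      apply: rect_loop_splitr; [clear -l0 k0; lra..|apply: rectCR_sub H'; clear -l0 k0; lra].
    apply: rect_loop_splitr; [clear -l0 k0; lra..|apply: rectCR_sub H'; clear -l0 k0; lra].
  have [Q1|Q1] := lerP `|rect_loop U V x (x + l / 2) y (y + k / 2)| (e * (l / 2 + k / 2) ^+ 2); last first.
    exists (x, y, n.+1); rewrite /bad /child /= El Ek El0 Ek0.
    by split; split => //; clear -l0 k0 x1 x2 y1 y2; lra.
  have [Q2|Q2] := lerP `|rect_loop U V x (x + l / 2) (y + k / 2) (y + k / 2 + k / 2)|
    (e * (l / 2 + k / 2) ^+ 2); last first.
    exists (x, y + k / 2, n.+1); rewrite /bad /child /= El Ek El0 Ek0.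
    by split; split => //; clear -l0 k0 x1 x2 y1 y2; lra.
  have [Q3|Q3] := lerP `|rect_loop U V (x + l / 2) (x + l / 2 + l / 2) y (y + k / 2)|
    (e * (l / 2 + k / 2) ^+ 2); last first.
    exists (x + l / 2, y, n.+1); rewrite /bad /child /= El Ek El0 Ek0.
    by split; split => //; clear -l0 k0 x1 x2 y1 y2; lra.
  have [Q4|Q4] := lerP
    `|rect_loop U V (x + l / 2) (x + l / 2 + l / 2) (y + k / 2) (y + k / 2 + k / 2)|
    (e * (l / 2 + k / 2) ^+ 2); last first.
    exists (x + l / 2, y + k / 2, n.+1); rewrite /bad /child /= El Ek El0 Ek0.
    by split; split => //; clear -l0 k0 x1 x2 y1 y2; lra.
  suff /(lt_le_trans G) : `|rect_loop U V x (x + l) y (y + k)| <= e * (l + k) ^+ 2.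
    by rewrite ltxx.
  rewrite E; apply: le_trans (ler_normD _ _) _.
  apply: le_trans (lerD (ler_normD _ _) (ler_normD _ _)) _.
  apply: le_trans (lerD (lerD Q1 Q2) (lerD Q3 Q4)) _.
  rewrite le_eqVlt; apply/orP; left; apply/eqP; by field.
have [nx nxP] : {nx & forall q, bad q -> bad (nx q) /\ child q (nx q)}.
  apply: (@choice _ _ (fun q q' => bad q -> bad q' /\ child q q')) => q.
  have [bq|nb] := pselect (bad q); last by exists q.
  by have [q' hq'] := step q bq; exists q'.
pose S n := iter n nx (a, c, 0%N).
have bS n : bad (S n) by elim: n => //= n /nxP[].
have S2 n : (S n).2 = n.
  by elim: n => //= n IH; have [_ [-> _ _ _ _]] := nxP _ (bS n); rewrite IH.
have [s hs] : exists s, forall n, (S n).1.1 <= s <= (S n).1.1 + (b - a) / 2 ^+ (S n).2.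
  apply: nested_point => n.
  - by have [_ []] := nxP _ (bS n).
  - by have [_ []] := nxP _ (bS n).
  - by rewrite lerDl divr_ge0 ?exprn_ge0 // subr_ge0.
have [t ht] : exists t, forall n, (S n).1.2 <= t <= (S n).1.2 + (d - c) / 2 ^+ (S n).2.
  apply: nested_point => n.
  - by have [_ []] := nxP _ (bS n).
  - by have [_ []] := nxP _ (bS n).
  - by rewrite lerDl divr_ge0 ?exprn_ge0 // subr_ge0.
have st : CRat U V s t.
  have := hs 0%N; have := ht 0%N; rewrite /= expr0 !divr1 => h1 h2.
  by apply: H; lra.
have [r r0 hr] := rect_loop_local e0 st.
have small x : exists n, x / 2 ^+ n < r.
  exists (Num.truncn (`|x| / r)).+1.
  rewrite ltr_pdivrMr ?exprn_gt0 // mulrC -ltr_pdivrMr //.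
  have h1 : `|x| / r < 2 ^+ (Num.truncn (`|x| / r)).+1.
    apply: (@lt_trans _ _ (Num.truncn (`|x| / r)).+1%:R).
      by rewrite truncnS_gt.
    by rewrite -natrX ltr_nat ltn_expl.
  apply: le_lt_trans h1.
  by rewrite ler_pM2r ?invr_gt0 // ler_norm.
have [n1 hn1] := small (b - a).
have [n2 hn2] := small (d - c).
pose n := maxn n1 n2.
have mono (x : R) n' m : 0 <= x -> (n' <= m)%N -> x / 2 ^+ m <= x / 2 ^+ n'.
  move=> x0 nm; apply: (ler_wpM2l x0).
  by rewrite lef_pV2 ?posrE ?exprn_gt0 // ler_weXn2l // ler1n.
have [y1 y2 y3 y4 y5] := bS n.
suff /(lt_le_trans y5) : `|rect_loop U V (S n).1.1 ((S n).1.1 + (b - a) / 2 ^+ (S n).2)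
    (S n).1.2 ((S n).1.2 + (d - c) / 2 ^+ (S n).2)|
  <= e * ((b - a) / 2 ^+ (S n).2 + (d - c) / 2 ^+ (S n).2) ^+ 2.
  by rewrite ltxx.
have E1 (x y : R) : x + y - x = y by ring.
have := hr _ _ _ _ (hs n) (ht n); rewrite !E1 S2; apply.
- by apply: le_lt_trans hn1; apply: mono (leq_maxl _ _); rewrite subr_ge0.
- by apply: le_lt_trans hn2; apply: mono (leq_maxr _ _); rewrite subr_ge0.
- by rewrite S2 in y1 y2 y3 y4; apply: rectCR_sub H.
Qed.

Lemma goursat U V a b c d : a <= b -> c <= d -> rectCR U V a b c d ->
  segint (fun s => U s c - U s d) a b = segint (fun t => V b t - V a t) c d.
Proof.
move=> ab cd H; apply/eqP; rewrite -subr_eq0 -normr_le0 -/(rect_loop _ _ _ _ _ _).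
set p := ((b - a) + (d - c)) ^+ 2.
have p0 : 0 <= p by rewrite exprn_even_ge0.
apply/ler_addgt0Pr => e e0; rewrite add0r.
have p1 : 0 < p + 1 by rewrite ltr_wpDl.
have h := rect_loop_small (divr_gt0 e0 p1) ab cd H.
apply: le_trans h _; rewrite -/p mulrAC ler_pdivrMr // ler_wpM2l //; first exact: ltW.
by rewrite lerDl.
Qed.

End Goursat.

(** * Complex differentiability *)

Import Normc.
Local Open Scope complex_scope.

Notation Re := complex.Re.
Notation Im := complex.Im.

Section ComplexNorm.
Variable R : realType.
Implicit Types (z w : R[i]) (x y : R).

Lemma normc_ge0 z : 0 <= normc z.
Proof. by case: z => a b; exact: sqrtr_ge0. Qed.

Lemma normcB z w : normc (z - w) = normc (w - z).
Proof. by rewrite -normcN opprB. Qed.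

Lemma le_normcB z w : normc (z - w) <= normc z + normc w.
Proof. by rewrite -(normcN w); exact: le_normcD. Qed.

Lemma ler_dist_normc z w : normc z - normc w <= normc (z - w).
Proof. by rewrite lerBlDr -{1}(subrK w z) le_normcD. Qed.

Lemma normc_eq0 z : (normc z == 0) = (z == 0).
Proof. by apply/eqP/eqP => [/eq0_normc //|->]; rewrite normc0. Qed.

Lemma normc_gt0 z : (0 < normc z) = (z != 0).
Proof. by rewrite lt_def normc_ge0 andbT normc_eq0. Qed.

Lemma normcX z n : normc (z ^+ n) = normc z ^+ n.
Proof. by elim: n => [|n IH]; rewrite ?expr0 ?normc1 // !exprS normcM IH. Qed.

Lemma normc_sqr z : normc z ^+ 2 = Re z ^+ 2 + Im z ^+ 2.
Proof. by case: z => a b /=; rewrite sqr_sqrtr // addr_ge0 ?sqr_ge0. Qed.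

Lemma Re_le_normc z : `|Re z| <= normc z.
Proof.
rewrite -(ler_pXn2r (n := 2)) ?nnegrE ?normc_ge0 //.
by rewrite normc_sqr real_normK ?num_real // lerDl sqr_ge0.
Qed.

Lemma Im_le_normc z : `|Im z| <= normc z.
Proof.
rewrite -(ler_pXn2r (n := 2)) ?nnegrE ?normc_ge0 //.
by rewrite normc_sqr real_normK ?num_real // lerDr sqr_ge0.
Qed.

Lemma normc_le z : normc z <= `|Re z| + `|Im z|.
Proof.
rewrite -(ler_pXn2r (n := 2)) ?nnegrE ?normc_ge0 ?addr_ge0 //.
rewrite normc_sqr sqrrD !real_normK ?num_real // -addrA lerD2l lerDr.
by rewrite mulrn_wge0 // mulr_ge0.
Qed.

Lemma normc_real x : normc x%:C = `|x|.
Proof. by rewrite /= expr0n /= addr0 sqrtr_sqr. Qed.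

Lemma normc_conj z : normc (conjc z) = normc z.
Proof. by case: z => a b /=; rewrite sqrrN. Qed.

Lemma cReB z w : Re (z - w) = Re z - Re w. Proof. by case: z w => a b []. Qed.
Lemma cImB z w : Im (z - w) = Im z - Im w. Proof. by case: z w => a b []. Qed.
Lemma cReD z w : Re (z + w) = Re z + Re w. Proof. by case: z w => a b []. Qed.
Lemma cImD z w : Im (z + w) = Im z + Im w. Proof. by case: z w => a b []. Qed.
Lemma cReM z w : Re (z * w) = Re z * Re w - Im z * Im w.
Proof. by case: z w => a b []. Qed.
Lemma cImM z w : Im (z * w) = Re z * Im w + Im z * Re w.
Proof. by case: z w => a b []. Qed.

Lemma complex_eq z w : Re z = Re w -> Im z = Im w -> z = w.
Proof. by case: z w => a b [c d] /= -> ->. Qed.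

Lemma conjcM z w : conjc (z * w) = conjc z * conjc w.
Proof. by case: z w => a b [c d]; apply: complex_eq => /=; ring. Qed.

Lemma conjcB z w : conjc (z - w) = conjc z - conjc w.
Proof. by case: z w => a b [c d]; apply: complex_eq => /=; ring. Qed.

Lemma conjcN z : conjc (- z) = - conjc z.
Proof. by case: z. Qed.

Lemma realcM x y : (x * y)%:C = x%:C * y%:C :> R[i].
Proof. exact: (rmorphM (real_complex R)). Qed.

Lemma realcV x : (x^-1)%:C = (x%:C)^-1 :> R[i].
Proof. exact: (fmorphV (real_complex R)). Qed.

Lemma realc_neq0 x : x != 0 -> x%:C != 0 :> R[i].
Proof. by rewrite -normc_gt0 normc_real normr_gt0. Qed.

End ComplexNorm.

Section Holo.
Variable R : realType.
Implicit Types (f g : R[i] -> R[i]) (z w : R[i]).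

Definition ccont f z := forall e : R, 0 < e -> exists2 d : R, 0 < d &
  forall w, normc (w - z) < d -> normc (f w - f z) < e.

(** Caratheodory's form of complex differentiability at [z]: the difference
quotient extends continuously, and [p z] is the derivative. Sums, products,
inverses and composites then reduce to algebraic identities. *)
Definition holo f z := exists2 p, ccont p z & forall w, f w - f z = p w * (w - z).

Lemma ccont_cst c z : ccont (fun=> c) z.
Proof. by move=> e e0; exists 1 => // w _; rewrite subrr normc0. Qed.

Lemma ccont_id z : ccont id z.
Proof. by move=> e e0; exists e. Qed.

Lemma ccontN f z : ccont f z -> ccont (fun w => - f w) z.
Proof.
move=> h e /h[d d0 {}h]; exists d => // w /h.
by rewrite -opprD normcN.
Qed.

Lemma ccontD f g z : ccont f z -> ccont g z -> ccont (fun w => f w + g w) z.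
Proof.
move=> hf hg e e0; have e20 : 0 < e / 2 by rewrite divr_gt0.
have [d1 d10 {}hf] := hf _ e20; have [d2 d20 {}hg] := hg _ e20.
exists (Num.min d1 d2); first by rewrite lt_min d10.
move=> w; rewrite lt_min => /andP[/hf h1 /hg h2].
rewrite (_ : _ - _ = (f w - f z) + (g w - g z)); last by ring.
by apply: le_lt_trans (le_normcD _ _) _; rewrite (splitr e) ltrD.
Qed.

Lemma ccontM f g z : ccont f z -> ccont g z -> ccont (fun w => f w * g w) z.
Proof.
move=> hf hg e e0.
set K := normc (f z) + normc (g z) + 1.
have K0 : 0 < K by rewrite ltr_wpDl // addr_ge0 // normc_ge0.
set e1 := Num.min 1 (e / K).
have e10 : 0 < e1 by rewrite lt_min ltr01 divr_gt0.
have [d1 d10 {}hf] := hf _ e10; have [d2 d20 {}hg] := hg _ e10.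
exists (Num.min d1 d2); first by rewrite lt_min d10.
move=> w; rewrite lt_min => /andP[/hf h1 /hg h2].
rewrite (_ : _ - _ = (f w - f z) * (g w - g z) + (f z * (g w - g z) + g z * (f w - f z))); last by ring.
apply: le_lt_trans (le_normcD _ _) _.
rewrite normcM.
have h3 : normc (f z * (g w - g z) + g z * (f w - f z)) <= (normc (f z) + normc (g z)) * e1.
  apply: le_trans (le_normcD _ _) _; rewrite !normcM mulrDl.
  by apply: lerD; apply: ler_wpM2l; rewrite ?normc_ge0 // ltW.
have h4 : normc (f w - f z) * normc (g w - g z) < e1.
  apply: (@le_lt_trans _ _ (1 * normc (g w - g z))); last by rewrite mul1r.
  apply: ler_wpM2r; first exact: normc_ge0.
  by apply: ltW (lt_le_trans h1 _); rewrite ge_min lexx.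
have : K * e1 <= e.
  rewrite mulrC -ler_pdivlMr //; by rewrite ge_min lexx orbT.
by rewrite /K in h3 *; nra.
Qed.

Lemma ccont_neq0 f z : ccont f z -> f z != 0 -> exists2 d : R, 0 < d &
  forall w, normc (w - z) < d -> normc (f z) / 2 < normc (f w).
Proof.
move=> hf nz; have e0 : 0 < normc (f z) / 2 by rewrite divr_gt0 // normc_gt0.
have [d d0 h] := hf _ e0; exists d => // w /h; rewrite normcB => h1.
have := ler_dist_normc (f z) (f w); lra.
Qed.

Lemma ccontV f z : ccont f z -> f z != 0 -> ccont (fun w => (f w)^-1) z.
Proof.
move=> hf nz e e0.
have N0 : 0 < normc (f z) by rewrite normc_gt0.
have [d1 d10 h1] := ccont_neq0 hf nz.
have e10 : 0 < e * (normc (f z) / 2) * normc (f z) by rewrite !mulr_gt0.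
have [d2 d20 h2] := hf _ e10.
exists (Num.min d1 d2); first by rewrite lt_min d10.
move=> w; rewrite lt_min => /andP[/h1 g1 /h2 g2].
have M0 : 0 < normc (f w) by apply: lt_trans g1; rewrite divr_gt0.
have nw : f w != 0 by rewrite -normc_gt0.
rewrite (_ : _ - _ = (f z - f w) / (f w * f z)); last by field; rewrite nw nz.
rewrite normcM normcV normcM ltr_pdivrMr ?mulr_gt0 // normcB.
apply: lt_le_trans g2 _; rewrite [leRHS]mulrA; apply: ler_wpM2r; first exact: ltW.
by apply: ler_wpM2l; exact: ltW.
Qed.

Lemma ccont_comp f g z : ccont f z -> ccont g (f z) -> ccont (fun w => g (f w)) z.
Proof.
move=> hf hg e /hg[d d0 h1]; have [d' d'0 h2] := hf _ d0.
by exists d' => // w /h2 /h1.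
Qed.

Lemma eq_ccont f g z : f =1 g -> ccont f z -> ccont g z.
Proof. by move=> /funext ->. Qed.

Lemma holo_cont f z : holo f z -> ccont f z.
Proof.
move=> [p hp E].
have : ccont (fun w => f z + p w * (w - z)) z.
  apply: ccontD; first exact: ccont_cst.
  apply: ccontM => //; apply: ccontD; [exact: ccont_id|exact: ccont_cst].
by apply: eq_ccont => w; rewrite -E addrC subrK.
Qed.

Lemma eq_holo f g z : f =1 g -> holo f z -> holo g z.
Proof. by move=> /funext ->. Qed.

Lemma holo_cst c z : holo (fun=> c) z.
Proof. by exists (fun=> 0) => [|w]; [exact: ccont_cst|rewrite subrr mul0r]. Qed.

Lemma holo_id z : holo id z.
Proof. by exists (fun=> 1) => [|w]; [exact: ccont_cst|rewrite mul1r]. Qed.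

Lemma holoD f g z : holo f z -> holo g z -> holo (fun w => f w + g w) z.
Proof.
move=> [p hp Ep] [q hq Eq]; exists (fun w => p w + q w); first exact: ccontD.
by move=> w; rewrite mulrDl -Ep -Eq; ring.
Qed.

Lemma holoM f g z : holo f z -> holo g z -> holo (fun w => f w * g w) z.
Proof.
move=> hf hg; have cg := holo_cont hg; move: hf hg => [p hp Ep] [q hq Eq].
exists (fun w => p w * g w + f z * q w).
  by apply: ccontD; apply: ccontM => //; exact: ccont_cst.
move=> w; rewrite mulrDl -mulrA (mulrC (g w)) mulrA -Ep -mulrA -Eq; ring.
Qed.

Lemma holoN f z : holo f z -> holo (fun w => - f w) z.
Proof.
move=> h; apply: (@eq_holo (fun w => -1 * f w)); first by move=> w; rewrite mulN1r.
by apply: holoM => //; exact: holo_cst.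
Qed.

Lemma holoB f g z : holo f z -> holo g z -> holo (fun w => f w - g w) z.
Proof. by move=> hf hg; apply: holoD => //; exact: holoN. Qed.

Lemma holoV f z : holo f z -> f z != 0 -> holo (fun w => (f w)^-1) z.
Proof.
move=> hf nz; have cf := holo_cont hf; have [p hp Ep] := hf.
have [d d0 hd] := ccont_neq0 cf nz.
exists (fun w => if f w == 0 then - (f z)^-1 / (w - z) else - p w / (f w * f z)).
  have : ccont (fun w => - p w * (f w * f z)^-1) z.
    apply: ccontM; first exact: ccontN.
    apply: ccontV; last by rewrite mulf_neq0.
    by apply: ccontM => //; exact: ccont_cst.
  move=> h e /h[d' d'0 {}h]; exists (Num.min d d'); first by rewrite lt_min d0.
  move=> w; rewrite lt_min => /andP[/hd h1 /h h2].
  rewrite (negbTE nz) ifF //; apply/negbTE; rewrite -normc_gt0.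
  by apply: lt_trans h1; rewrite divr_gt0 // normc_gt0.
move=> w; have [fw|fw] := eqVneq (f w) 0.
  rewrite fw invr0 sub0r mulrAC -mulrA mulfV ?mulr1 //.
  by rewrite subr_eq0; apply: contraNneq nz => <-; rewrite fw.
rewrite mulrAC mulNr -Ep; field; by rewrite fw nz.
Qed.

Lemma holo_comp f g z : holo f z -> holo g (f z) -> holo (fun w => g (f w)) z.
Proof.
move=> hf; have cf := holo_cont hf; move: hf => [p hp Ep] [q hq Eq].
exists (fun w => q (f w) * p w); last by move=> w; rewrite Eq Ep mulrA.
by apply: ccontM => //; exact: ccont_comp.
Qed.

Lemma holo_approx f z : holo f z -> exists D : R[i], forall e : R, 0 < e ->
  exists2 d : R, 0 < d & forall w, normc (w - z) < d ->
    normc (f w - f z - D * (w - z)) <= e * normc (w - z).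
Proof.
move=> [p hp Ep]; exists (p z) => e /hp[d d0 h]; exists d => // w /h /ltW h1.
by rewrite Ep -mulrBl normcM; apply: ler_wpM2r => //; exact: normc_ge0.
Qed.

(** The slope [p] is the difference quotient, completed by its limit. *)
Lemma approx_holo f z (D : R[i]) : (forall e : R, 0 < e ->
  exists2 d : R, 0 < d & forall w, normc (w - z) < d ->
    normc (f w - f z - D * (w - z)) <= e * normc (w - z)) -> holo f z.
Proof.
move=> h; exists (fun w => if w == z then D else (f w - f z) / (w - z)).
  move=> e e0; have [|d d0 {}h] := h (e / 2); first by rewrite divr_gt0.
  exists d => // w /h; rewrite eqxx; case: eqVneq => [|wz] h1.
    by rewrite subrr normc0.
  have n0 : 0 < normc (w - z) by rewrite normc_gt0 subr_eq0.
  apply: (@le_lt_trans _ _ (e / 2)); last by rewrite ltr_pdivrMr // ltr_pMr // ltr1n.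
  rewrite -(ler_pM2r n0) -normcM; apply: le_trans h1.
  by rewrite mulrBl divfK ?subr_eq0.
move=> w; case: eqVneq => [->|wz]; first by rewrite !subrr mulr0.
by rewrite divfK // subr_eq0.
Qed.

Lemma derivable_holo f z : derivable (f : R[i]^o -> R[i]^o) z 1 -> holo f z.
Proof.
move=> /cvg_ex[D hD]; apply: (@approx_holo _ _ D) => e e0.
move: hD => /cvgrPdist_le /(_ e%:C); rewrite ltcR => /(_ e0).
move=> /nbhs_ballP[d /= d0 hd].
have Ed : d = (Re d)%:C by rewrite RRe_real // ger0_real // ltW.
exists (Re d); first by rewrite -ltcR -Ed.
move=> w hw; have [->|wz] := eqVneq w z.
  by rewrite !subrr mulr0 subr0 normc0 mulr0.
have wz0 : w - z != 0 by rewrite subr_eq0.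
have hb : ball (0 : R[i]^o) d (w - z).
  rewrite -ball_normE /ball_ /= sub0r normrN Ed.
  by rewrite -[ltLHS]/((normc (w - z))%:C) ltcR.
have H := hd _ hb wz0.
have E1 : (w - z) *: (1 : R[i]^o) + z = w by rewrite [(_ *: _)]mulr1 subrK.
move: H; rewrite /= E1 -[leLHS]/((normc (D - (w - z)^-1 * (f w - f z)))%:C) lecR => H.
rewrite -normcN (_ : - _ = (D - (w - z)^-1 * (f w - f z)) * (w - z)).
  by rewrite normcM; apply: ler_wpM2r => //; exact: normc_ge0.
by rewrite mulrBl mulrAC mulVf // mul1r opprB.
Qed.

End Holo.

(** * Real derivatives and the complex exponential *)

Section RealDerivative.
Variable R : realType.
Implicit Types (f : R -> R) (x D : R).

Lemma is_derive_approx f x D : is_derive x 1 f D -> forall e : R, 0 < e ->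
  exists2 d : R, 0 < d & forall h, `|h| < d -> `|f (x + h) - f x - D * h| <= e * `|h|.
Proof.
move=> [hd hv] e e0.
have : h^-1 *: ((f \o shift x) (h *: 1) - f x) @[h --> 0^'] --> D.
  by rewrite -hv; exact: hd.
move=> /cvgrPdist_le /(_ _ e0) /nbhs_ballP[d /= d0 hD].
exists d => // h hh; have [->|h0] := eqVneq h 0.
  by rewrite addr0 subrr mulr0 subrr normr0 mulr0.
have hb : ball (0 : R) d h by rewrite -ball_normE /ball_ /= sub0r normrN.
have := hD _ hb h0; rewrite /= [(h *: 1)%E]mulr1 (addrC h) => H.
rewrite (_ : _ - _ = - (D - h^-1 *: (f (x + h) - f x)) * h).
  by rewrite normrM normrN; apply: ler_wpM2r.
by rewrite opprB mulrBl mulrAC mulVf // mul1r.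
Qed.

Lemma approx_is_derive f x D : (forall e : R, 0 < e ->
  exists2 d : R, 0 < d & forall h, `|h| < d -> `|f (x + h) - f x - D * h| <= e * `|h|) ->
  is_derive x 1 f D.
Proof.
move=> H.
have L : h^-1 *: ((f \o shift x) (h *: 1) - f x) @[h --> 0^'] --> D.
  apply/cvgrPdist_le => e e0; have [d d0 {}H] := H _ e0.
  apply/nbhs_ballP; exists d => //= h.
  rewrite -ball_normE /ball_ /= sub0r normrN => hh h0.
  have := H h hh; rewrite [(h *: 1)%E]mulr1 (addrC h) => H1.
  rewrite -(ler_pM2r (x := `|h|)) ?normr_gt0 //; apply: le_trans H1.
  rewrite -normrM -normrN le_eqVlt; apply/orP; left; apply/eqP; congr (`|_|).
  by rewrite -[(h^-1 *: _)]/(h^-1 * _) mulrBl mulrAC mulVf // mul1r opprB.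
by apply: DeriveDef; [exact: cvgP L|exact: cvg_lim L].
Qed.

Lemma is_derive_continuous f x D : is_derive x 1 f D -> {for x, continuous f}.
Proof.
move=> /is_derive_approx /(_ 1 ltr01)[d d0 H].
apply: (@lip_continuous _ _ _ (1 + `|D|) d) => // y hy.
have := H _ hy; rewrite [x + _]addrC subrK mul1r => H1.
rewrite -[f y - f x](subrK (D * (y - x))); apply: le_trans (ler_normD _ _) _.
by rewrite mulrDl mul1r normrM lerD2r.
Qed.

Lemma ge0_is_derive_le f (df : R -> R) a b : a <= b ->
  (forall x, a <= x <= b -> is_derive x 1 f (df x)) ->
  (forall x, a <= x <= b -> 0 <= df x) -> f a <= f b.
Proof.
move=> ab hd h0; rewrite -subr_ge0.
have [||c hc ->] := @MVT_segment R f df a b ab.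
- by move=> x; rewrite in_itv /= => /andP[/ltW x1 /ltW x2]; apply: hd; rewrite x1.
- by apply: seg_within => x hx; exact: is_derive_continuous (hd x hx).
- by rewrite mulr_ge0 ?subr_ge0 // h0.
Qed.

End RealDerivative.

Section Exponential.
Variable R : realType.
Implicit Types (f g : R[i] -> R[i]) (z w : R[i]) (s t : R).

Lemma holo_CR f s t : holo f (s +i* t) ->
  CRat (fun s t => Re (f (s +i* t))) (fun s t => Im (f (s +i* t))) s t.
Proof.
move=> /holo_approx[[A B] H]; exists A, B => e e0; have [d d0 {}H] := H _ e0.
exists (d / 2) => [|s' t' hs ht]; first by rewrite divr_gt0.
have E : (s' +i* t') - (s +i* t) = (s' - s) +i* (t' - t) by [].
have N : normc ((s' +i* t') - (s +i* t)) <= `|s' - s| + `|t' - t|.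
  by rewrite E; exact: normc_le.
have {}H : normc (f (s' +i* t') - f (s +i* t) - (A +i* B) * ((s' +i* t') - (s +i* t)))
    <= e * (`|s' - s| + `|t' - t|).
  apply: le_trans (H _ _) _; last by apply: ler_wpM2l => //; exact: ltW.
  by apply: le_lt_trans N _; rewrite (splitr d) ltrD.
split.
  apply: le_trans (le_trans (Re_le_normc _) H).
  by rewrite !cReB cReM E /= le_eqVlt; apply/orP; left; apply/eqP; congr (`|_|); ring.
apply: le_trans (le_trans (Im_le_normc _) H).
by rewrite !cImB cImM E /= le_eqVlt; apply/orP; left; apply/eqP; congr (`|_|); ring.
Qed.

Definition cexp z : R[i] := (expR (Re z))%:C * (cos (Im z) +i* sin (Im z)).

Lemma cexpD z w : cexp (z + w) = cexp z * cexp w.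
Proof.
rewrite /cexp cReD cImD expRD cosD sinD; apply: complex_eq; rewrite !(cReM, cImM) /=; ring.
Qed.

Lemma normc_cis t : normc (cos t +i* sin t) = 1.
Proof. by rewrite /= cos2Dsin2 sqrtr1. Qed.

Lemma normc_cexp z : normc (cexp z) = expR (Re z).
Proof. by rewrite normcM normc_real normc_cis mulr1 ger0_norm // expR_ge0. Qed.

Lemma holo_cexp z : holo cexp z.
Proof.
suff [p cp E] : holo cexp 0.
  (* by the addition formula, it is enough to differentiate at the origin *)
  apply: (@eq_holo _ (fun w => cexp z * cexp (w - z))).
    by move=> w; rewrite -cexpD addrC subrK.
  apply: holoM; first exact: holo_cst.
  apply: (@holo_comp _ (fun w => w - z)); first by apply: holoB; [exact: holo_id|exact: holo_cst].
  by rewrite subrr; exists p.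
apply: (@approx_holo _ _ _ 1) => e e0.
set k := Num.min 1 (e / 16).
have k0 : 0 < k by rewrite lt_min ltr01 divr_gt0.
have k1 : k <= 1 by rewrite ge_min lexx.
have k2 : k <= e / 16 by rewrite ge_min lexx orbT.
clearbody k.
have [d1 d10 H1] := is_derive_approx (is_derive_expR (0 : R)) k0.
have [d2 d20 H2] := is_derive_approx (is_derive_cos (0 : R)) k0.
have [d3 d30 H3] := is_derive_approx (is_derive_sin (0 : R)) k0.
exists (Num.min k (Num.min d1 (Num.min d2 d3))); first by rewrite !lt_min k0 d10 d20 d30.
move=> [a b]; rewrite subr0 !lt_min => /and4P[hk h1 h2 h3].
have na := Re_le_normc (a +i* b); have nb := Im_le_normc (a +i* b).
rewrite /= in na nb.
set n := normc (a +i* b) in hk h1 h2 h3 *.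
rewrite -/(normc (a +i* b)) -/n in na nb.
have {}H1 := H1 _ (le_lt_trans na h1).
have {}H2 := H2 _ (le_lt_trans nb h2).
have {}H3 := H3 _ (le_lt_trans nb h3).
rewrite !add0r expR0 mul1r in H1.
rewrite !add0r cos0 sin0 oppr0 mul0r subr0 in H2.
rewrite !add0r cos0 sin0 subr0 mul1r in H3.
have eab : `|expR a - 1| <= 2 * n.
  rewrite -(subrK a (expR a - 1)); apply: le_trans (ler_normD _ _) _.
  have : k * `|a| <= 1 * n by apply: ler_pM => //; exact: ltW.
  by lra.
have ea : `|expR a| <= 3.
  rewrite -(subrK 1 (expR a)); apply: le_trans (ler_normD _ _) _.
  rewrite normr1; have := ltW hk; lra.
have n0 : 0 <= n by exact: normc_ge0.
apply: le_trans (normc_le _) _.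
have E1 : Re (cexp (a +i* b) - cexp 0 - 1 * (a +i* b)) = (expR a - 1 - a) + expR a * (cos b - 1).
  by rewrite !cReB /cexp !cReM /= expR0 cos0 sin0; ring.
have E2 : Im (cexp (a +i* b) - cexp 0 - 1 * (a +i* b)) = expR a * (sin b - b) + b * (expR a - 1).
  by rewrite !cImB /cexp !cImM /= expR0 cos0 sin0; ring.
have P1 : k * `|a| <= e / 16 * n by apply: ler_pM => //; exact: ltW.
have P2 : k * `|b| <= e / 16 * n by apply: ler_pM => //; exact: ltW.
have Q1 : `|expR a * (cos b - 1)| <= 3 * (e / 16 * n).
  by rewrite normrM; apply: ler_pM => //; exact: le_trans H2 P2.
have Q2 : `|expR a * (sin b - b)| <= 3 * (e / 16 * n).
  by rewrite normrM; apply: ler_pM => //; exact: le_trans H3 P2.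
have Q3 : `|b * (expR a - 1)| <= e / 16 * (2 * n).
  by rewrite normrM; apply: ler_pM => //; apply: le_trans nb (le_trans (ltW hk) k2).
rewrite E1 E2.
have R1 := ler_normD (expR a - 1 - a) (expR a * (cos b - 1)).
have R2 := ler_normD (expR a * (sin b - b)) (b * (expR a - 1)).
have := mulr_ge0 (ltW e0) n0.
clear -H1 P1 Q1 Q2 Q3 R1 R2 n0 e0; lra.
Qed.

End Exponential.

(** * Mean values over circles *)

Section CircleMean.
Variable R : realType.
Implicit Types (f g F p q : R[i] -> R[i]) (z w : R[i]) (s t r : R).

Lemma holo_local f g z d : 0 < d -> (forall w, normc (w - z) < d -> f w = g w) ->
  holo f z -> holo g z.
Proof.
move=> d0 E /holo_approx[D H]; apply: (@approx_holo _ _ _ D) => e e0.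
have [d' d'0 {}H] := H _ e0; exists (Num.min d d'); first by rewrite lt_min d0.
move=> w; rewrite lt_min => /andP[w1 w2].
by rewrite -!E // ?subrr ?normc0 //; exact: H.
Qed.

(** In the coordinates [w = exp (s + i t)] circles become vertical segments, and the
horizontal sides of a rectangle of height [2 * pi] cancel by periodicity. So the
mean does not depend on the radius, and it tends to [F 0] as the radius does to [0]. *)
Lemma circle_mean F r : (forall w, 0 < normc w < 1 -> holo F w) -> ccont F 0 ->
  0 < r < 1 ->
  segint (fun t => Re (F (cexp (ln r +i* t)))) 0 (pi *+ 2) = pi *+ 2 * Re (F 0).
Proof.
move=> hF cF /andP[r0 r1].
have pi0 : 0 <= pi *+ 2 :> R by rewrite mulrn_wge0 // pi_ge0.
pose U s t := Re (F (cexp (s +i* t))).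
pose V s t := Im (F (cexp (s +i* t))).
have CR s t : s < 0 -> CRat V (fun s t => - U s t) s t.
  move=> s0; apply: CRat_rot.
  apply: (@holo_CR _ (fun z => F (cexp z))).
  apply: holo_comp; first exact: holo_cexp.
  by apply: hF; rewrite normc_cexp expR_gt0 /= -expR0 ltr_expR.
have per s : V s 0 = V s (pi *+ 2).
  by rewrite /V /cexp /= cos0 sin0 cos2pi sin2pi.
have l0 : ln r < 0 by rewrite ln_lt0 // r0.
have cU s : s < 0 -> seg_continuous (U s) 0 (pi *+ 2).
  move=> s0 t _; have [_ _ _ h] := CRat_cont (CR s t s0).
  rewrite (_ : U s = fun t => - - U s t); first exact: continuousN.
  by apply/funext => x; rewrite opprK.
have J a : a <= ln r -> segint (U a) 0 (pi *+ 2) = segint (U (ln r)) 0 (pi *+ 2).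
  move=> ar; have al0 := le_lt_trans ar l0.
  have rCR : rectCR V (fun s t => - U s t) a (ln r) 0 (pi *+ 2).
    by move=> s t /andP[_ s1] _; apply: CR; exact: le_lt_trans s1 l0.
  have H := goursat ar pi0 rCR.
  have E0 : segint (fun s => V s 0 - V s (pi *+ 2)) a (ln r) = 0.
    rewrite (@eq_segint _ _ (fun=> 0)) ?segint_cst ?mul0r //.
    by move=> x _; rewrite -per subrr.
  have : segint (fun t => U a t - U (ln r) t) 0 (pi *+ 2) = 0.
    by rewrite -[RHS]E0 H; apply: eq_segint => x _; rewrite opprK addrC.
  by rewrite segintB; [move/eqP; rewrite subr_eq0 => /eqP|exact: cU..].
rewrite -/(U (ln r)) mulrC; apply/eqP; rewrite -subr_eq0 -normr_le0.
apply/ler_addgt0Pr => e e0; rewrite add0r.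
have pi1 : 0 < pi *+ 2 :> R by rewrite pmulrn_lgt0 // pi_gt0.
have [d d0 hd] := cF _ (divr_gt0 e0 pi1).
set a := Num.min (ln r) (ln (d / 2)).
have ar : a <= ln r by rewrite ge_min lexx.
have ad : expR a < d.
  apply: (@le_lt_trans _ _ (d / 2)); last by rewrite ltr_pdivrMr // ltr_pMr // ltr1n.
  rewrite -[leRHS]lnK ?posrE ?divr_gt0 // ler_expR.
  by rewrite ge_min lexx orbT.
rewrite -(J a ar) -[X in _ * X](subr0 (pi *+ 2)).
rewrite -[leRHS](divfK (lt0r_neq0 pi1)) -[X in _ / _ * X](subr0 (pi *+ 2)).
apply: segint_near_cst => //; first by apply: cU; exact: le_lt_trans ar l0.
move=> t _; rewrite -cReB; apply: le_trans (Re_le_normc _) _.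
by apply: ltW; apply: hd; rewrite subr0 normc_cexp.
Qed.

(** On the circle of radius [r], weight [Re g] with [1 + cos], the cosine being that of
the angle from a given direction. The mean is nonnegative, and by the mean value
property it is [Re (g 0)] plus [r / 2] times a component of the derivative [p 0]. *)
Lemma derivative_le_Re g p : (forall w, normc w < 1 -> holo g w) ->
  (forall w, normc w < 1 -> 0 <= Re (g w)) ->
  ccont p 0 -> (forall w, normc w < 1 -> g w - g 0 = p w * w) ->
  normc (p 0) <= 2 * Re (g 0).
Proof.
move=> hg g0 cp Ep.
have g00 : 0 <= Re (g 0) by apply: g0; rewrite normc0.
have [->|p0] := eqVneq (p 0) 0; first by rewrite normc0 mulr_ge0.
have n0 : 0 < normc (p 0) by rewrite normc_gt0.
(* the direction in which that component is [- normc (p 0)] *)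
pose h : R[i] := - (p 0 / (normc (p 0))%:C).
have nh : normc h = 1.
  by rewrite normcN normcM normcV normc_real ger0_norm ?normc_ge0 // divff // lt0r_neq0.
have hp : p 0 * conjc h = - (normc (p 0))%:C.
  have : (normc (p 0))%:C != 0 by rewrite -normc_gt0 normc_real normr_gt0 lt0r_neq0.
  rewrite /h; case: (p 0) n0 => a b; set n := normc _ => n0 nn.
  have En : a ^+ 2 + b ^+ 2 = n ^+ 2 by rewrite normc_sqr.
  rewrite -(fmorphV (real_complex R)).
  apply: complex_eq; rewrite /= !(mulr0, mul0r, subr0, addr0, add0r, oppr0).
    transitivity (- ((a ^+ 2 + b ^+ 2) / n)); first by ring.
    by rewrite En expr2 mulfK // lt0r_neq0.
  ring.
have key r : 0 < r < 1 -> r * normc (p 0) <= 2 * Re (g 0).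
  move=> hr; have /andP[r0 r1] := hr.
  have rC0 : (r%:C : R[i]) != 0 by rewrite -normc_gt0 normc_real normr_gt0 lt0r_neq0.
  (* as [conjc w = r ^+ 2 / w] on the circle, [Re (F w)] is there the weighted [Re (g w)] *)
  pose F w := g w * (1 + h * w / (2 * r)%:C) + p w * ((r / 2)%:C * conjc h)
              + conjc (g 0 * conjc h) * w / (2 * r)%:C.
  have cF : ccont F 0.
    rewrite /F; apply: ccontD; [apply: ccontD|].
    - apply: ccontM; first by apply: holo_cont; apply: hg; rewrite normc0.
      apply: ccontD; first exact: ccont_cst.
      by apply: ccontM; [apply: ccontM; [exact: ccont_cst|exact: ccont_id]|exact: ccont_cst].
    - by apply: ccontM => //; exact: ccont_cst.
    - by apply: ccontM; [apply: ccontM; [exact: ccont_cst|exact: ccont_id]|exact: ccont_cst].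
  have hF w : 0 < normc w < 1 -> holo F w.
    move=> /andP[w0 w1]; have hgw := hg w w1.
    apply: (@holo_local (fun w => g w * (1 + h * w / (2 * r)%:C)
       + (g w - g 0) / w * ((r / 2)%:C * conjc h)
       + conjc (g 0 * conjc h) * w / (2 * r)%:C) _ _ (Num.min (normc w) (1 - normc w))).
    - by rewrite lt_min w0 subr_gt0.
    - move=> w'; rewrite lt_min => /andP[h1 h2]; rewrite /F Ep; last first.
        have := le_normcD w (w' - w); rewrite addrC subrK; lra.
      rewrite mulfK // -normc_gt0.
      have := ler_dist_normc w w'; rewrite normcB; lra.
    - apply: holoD; first apply: holoD.
      + apply: holoM => //; apply: holoD; first exact: holo_cst.
        by apply: holoM; [apply: holoM; [exact: holo_cst|exact: holo_id]|exact: holo_cst].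
      + apply: holoM; last exact: holo_cst.
        apply: holoM; first by apply: holoB => //; exact: holo_cst.
        by apply: holoV; [exact: holo_id|rewrite -normc_gt0].
      + by apply: holoM; [apply: holoM; [exact: holo_cst|exact: holo_id]|exact: holo_cst].
  have M := circle_mean hF cF hr.
  have F0 : Re (F 0) = Re (g 0) - r / 2 * normc (p 0).
    rewrite /F !(mulr0, mul0r, addr0) mulr1 mulrCA hp cReD cReM /=; ring.
  have pi1 : 0 < pi *+ 2 :> R by rewrite pmulrn_lgt0 // pi_gt0.
  suff : 0 <= Re (F 0) by rewrite F0; lra.
  rewrite -(pmulr_rge0 _ pi1) -M.
  apply: Rintegral_ge0 => t _.
  set w := cexp _; have nw : normc w = r by rewrite normc_cexp lnK.
  have w1 : normc w < 1 by rewrite nw.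
  have w0 : w != 0 by rewrite -normc_gt0 nw.
  have Eww : w * conjc w = (r ^+ 2)%:C.
    by rewrite -nw normc_sqr; case: (w) => a b; apply: complex_eq => /=; ring.
  have -> : Re (F w) = Re (g w) * (1 + Re (h * w) / r).
    have {F0 M cF hF} -> : F w = g w * (1 + (h * w + conjc (h * w)) / (2 * r)%:C)
         + (conjc (g 0 * conjc h) * w - conjc (conjc (g 0 * conjc h) * w)) / (2 * r)%:C.
      have -> : F w = g w * (1 + h * w / (2 * r)%:C) + (g w - g 0) / w * ((r / 2)%:C * conjc h)
              + conjc (g 0 * conjc h) * w / (2 * r)%:C by rewrite /F Ep // mulfK.
      have -> : w^-1 = conjc w / (r ^+ 2)%:C.
        by rewrite -Eww; field; rewrite conjc_eq0 w0.
      have two : 2%:C = 2 :> R[i] by exact: (rmorph_nat (real_complex R)).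
      rewrite !conjcM !conjcK expr2 !realcM realcV two.
      by field; rewrite rC0.
    have Hs (z : R[i]) : Re ((z - conjc z) / (2 * r)%:C) = 0.
      by rewrite -realcV; case: z => x y /=; ring.
    have Ha (z : R[i]) : (z + conjc z) / (2 * r)%:C = (Re z / r)%:C.
      rewrite -realcV; case: z => x y; apply: complex_eq => /=; last by ring.
      by field; exact: lt0r_neq0.
    have Hr (A B : R[i]) (x : R) : Re B = 0 -> Re (A * (1 + x%:C) + B) = Re A * (1 + x).
      by case: A B => A1 A2 [B1 B2] /= ->; ring.
    by rewrite Ha; apply: Hr.
  apply: mulr_ge0; first exact: g0.
  have := Re_le_normc (h * w); rewrite normcM nh nw mul1r ler_norml => /andP[h1 _].
  rewrite -(mulfV (lt0r_neq0 r0)) -mulrDl divr_ge0 //; lra.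
apply/ler_addgt0Pr => e e0.
set k := e / (normc (p 0) + e).
have k0 : 0 < k by rewrite divr_gt0 // addr_gt0.
have k1 : k < 1 by rewrite ltr_pdivrMr ?mul1r ?ltrDr // addr_gt0.
have K : k * normc (p 0) <= e.
  rewrite mulrAC ler_pdivrMr ?addr_gt0 // mulrDr lerDl; apply: mulr_ge0; exact: ltW.
have := key (1 - k); rewrite subr_gt0 k1 gtrBl k0 => /(_ isT).
by rewrite mulrBl mul1r; lra.
Qed.
End CircleMean.

(** * Growth of Pick functions along the imaginary axis *)

Section Pick.
Variable R : realType.
Implicit Types (Q q : R[i] -> R[i]) (z w : R[i]) (s t r y : R).

(** Nevanlinna functions seen on the upper half-plane only, where any map preserving
that half-plane acts on them. *)
Definition pick_fun Q := forall z, 0 < Im z -> holo Q z /\ 0 <= Im (Q z).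

Lemma cayley_uhp w : normc w < 1 -> 0 < Re ((1 + w) / (1 - w)).
Proof.
move=> w1; have w0 : 1 - w != 0.
  rewrite -normc_gt0; have := ler_dist_normc 1 w; rewrite normc1; lra.
have := divfK w0 (1 + w); move: (_ / _) => v.
have : normc w ^+ 2 < 1 by rewrite expr_lt1 // normc_ge0.
rewrite normc_sqr; case: v w {w1 w0} => p q [a b] /= h [E1 E2].
rewrite ltNge; apply/negP => p0.
have : 1 - a ^+ 2 - b ^+ 2 = p * ((1 - a) ^+ 2 + b ^+ 2).
  have F1 : p * (1 - a) + q * b = 1 + a by lra.
  have F2 : q * (1 - a) - p * b = b by lra.
  have G1 : (p * (1 - a) + q * b) * (1 - a) = (1 + a) * (1 - a) by rewrite F1.
  have G2 : (q * (1 - a) - p * b) * b = b * b by rewrite F2.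
  clear -G1 G2; lra.
have : p * ((1 - a) ^+ 2 + b ^+ 2) <= 0.
  by rewrite mulr_le0_ge0 // addr_ge0 // sqr_ge0.
lra.
Qed.

(** The Schwarz-Pick inequality: the Cayley transform of the disc onto the half-plane
takes [0] to [0 +i* y] with derivative [2 * y * 'i], and composing [- i Q] with it
gives a function with nonnegative real part on the disc. *)
Lemma schwarz_pick Q q y : pick_fun Q -> 0 < y -> ccont q (0 +i* y) ->
  (forall w, Q w - Q (0 +i* y) = q w * (w - (0 +i* y))) ->
  y * normc (q (0 +i* y)) <= Im (Q (0 +i* y)).
Proof.
move=> hQ y0 cq Eq.
pose m w : R[i] := (0 +i* y) * ((1 + w) / (1 - w)).
have m0 : m 0 = 0 +i* y by rewrite /m addr0 subr0 divr1 mulr1.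
have hm w : normc w < 1 -> holo m w.
  move=> w1; apply: holoM; first exact: holo_cst.
  apply: holoM; first by apply: holoD; [exact: holo_cst|exact: holo_id].
  apply: holoV; first by apply: holoB; [exact: holo_cst|exact: holo_id].
  rewrite -normc_gt0; have := ler_dist_normc 1 w; rewrite normc1; lra.
have Im_m w : normc w < 1 -> 0 < Im (m w).
  by move=> w1; rewrite /m cImM /= mul0r add0r mulr_gt0 // cayley_uhp.
have n0 : normc (0 : R[i]) < 1 by rewrite normc0.
pose g w := (0 -i* 1) * Q (m w).
have Re_g w : Re (g w) = Im (Q (m w)).
  by rewrite /g cReM /= mul0r sub0r mulN1r opprK.
pose p w := (2 * y)%:C * (q (m w) / (1 - w)).
have cp : ccont p 0.
  apply: ccontM; first exact: ccont_cst.
  apply: ccontM; first by apply: ccont_comp; [exact: holo_cont (hm _ n0)|rewrite m0].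
  apply: ccontV; last by rewrite subr0 oner_neq0.
  by apply: holo_cont; apply: holoB; [exact: holo_cst|exact: holo_id].
have Ep w : normc w < 1 -> g w - g 0 = p w * w.
  move=> w1; have w0 : 1 - w != 0.
    rewrite -normc_gt0; have := ler_dist_normc 1 w; rewrite normc1; lra.
  rewrite /g -mulrBr m0 Eq /p.
  have -> : m w - (0 +i* y) = (0 +i* y) * (2 * w / (1 - w)) by rewrite /m; field.
  have -> : (2 * y)%:C = (0 -i* 1) * (0 +i* y) * 2.
    by rewrite realcM (_ : 2%:C = 2) ?(rmorph_nat (real_complex R)) //; apply: complex_eq => /=; ring.
  by ring.
have := @derivative_le_Re R g p _ _ cp Ep.
rewrite Re_g m0 /p m0 subr0 divr1 normcM normc_real ger0_norm; last by rewrite mulr_ge0 // ltW.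
rewrite -mulrA ler_pM2l //; apply.
- move=> w w1; apply: holoM; first exact: holo_cst.
  apply: holo_comp; first exact: hm.
  by have [] := hQ _ (Im_m w w1).
- by move=> w w1; rewrite Re_g; have [] := hQ _ (Im_m w w1).
Qed.

Lemma pick_axis_derivative Q y : pick_fun Q -> 0 < y -> exists D : R[i],
  [/\ y * normc D <= Im (Q (0 +i* y)),
      is_derive y 1 (fun t => Re (Q (0 +i* t))) (- Im D) &
      is_derive y 1 (fun t => Im (Q (0 +i* t))) (Re D)].
Proof.
move=> hQ y0; have [[q cq Eq] _] := hQ (0 +i* y) y0.
exists (q (0 +i* y)); split; first exact: schwarz_pick.
  apply: approx_is_derive => e e0; have [d d0 H] := cq _ e0.
  exists d => // h hd.
  have E : (0 +i* (y + h)) - (0 +i* y) = 0 +i* h :> R[i].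
    by apply: complex_eq => /=; ring.
  have N : normc (0 +i* h) = `|h| by rewrite /= expr0n /= add0r sqrtr_sqr.
  have := H (0 +i* (y + h)); rewrite E N => /(_ hd) h1.
  rewrite -cReB Eq E (_ : _ - _ = Re ((q (0 +i* (y + h)) - q (0 +i* y)) * (0 +i* h))).
    apply: le_trans (Re_le_normc _) _; rewrite normcM N.
    by apply: ler_wpM2r => //; exact: ltW.
  by rewrite !cReM cReB cImB /=; ring.
apply: approx_is_derive => e e0; have [d d0 H] := cq _ e0.
exists d => // h hd.
have E : (0 +i* (y + h)) - (0 +i* y) = 0 +i* h :> R[i].
  by apply: complex_eq => /=; ring.
have N : normc (0 +i* h) = `|h| by rewrite /= expr0n /= add0r sqrtr_sqr.
have := H (0 +i* (y + h)); rewrite E N => /(_ hd) h1.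
rewrite -cImB Eq E (_ : _ - _ = Im ((q (0 +i* (y + h)) - q (0 +i* y)) * (0 +i* h))).
  apply: le_trans (Im_le_normc _) _; rewrite normcM N.
  by apply: ler_wpM2r => //; exact: ltW.
by rewrite !cImM cReB cImB /=; ring.
Qed.

(** Let [u] and [v] be the real and imaginary parts on the axis. By the Schwarz-Pick
inequality [y * v y] has a nonnegative derivative, so that [y * v y <= v 1], and then
[|u'| <= v / y <= v 1 / y ^ 2] integrates to [|u y| <= |u 1| + v 1 / y]. *)
Lemma pick_growth Q : pick_fun Q ->
  exists2 C : R, 0 <= C & forall y, 0 < y <= 1 -> y * normc (Q (0 +i* y)) <= C.
Proof.
move=> hQ.
have [D HD] : {D : R -> R[i] & forall y, 0 < y ->
  [/\ y * normc (D y) <= Im (Q (0 +i* y)),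
      is_derive y 1 (fun t => Re (Q (0 +i* t))) (- Im (D y)) &
      is_derive y 1 (fun t => Im (Q (0 +i* t))) (Re (D y))]}.
  apply: (@choice _ _ (fun y D => 0 < y ->
  [/\ y * normc D <= Im (Q (0 +i* y)),
      is_derive y 1 (fun t => Re (Q (0 +i* t))) (- Im D) &
      is_derive y 1 (fun t => Im (Q (0 +i* t))) (Re D)])) => y.
  have [y0|y0] := ltP 0 y; last by exists 0.
  by have [D] := pick_axis_derivative hQ y0; exists D.
set u := (fun t => Re (Q (0 +i* t))) in HD; set v := (fun t => Im (Q (0 +i* t))) in HD.
have v0 y : 0 < y -> 0 <= v y by move=> y0; have [] := hQ (0 +i* y) y0.
have yv y : 0 < y <= 1 -> y * v y <= v 1.
  move=> /andP[y0 y1]; rewrite -[leRHS]mul1r.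
  apply: (@ge0_is_derive_le _ (fun t => t * v t) (fun t => t * Re (D t) + v t)) => // t /andP[t1 _].
    have t0 := lt_le_trans y0 t1; have [_ _ dv] := HD t t0.
    have dM := is_deriveM (is_derive_id t (1 : R)) dv.
    have E : t *: Re (D t) + v t *: 1 = t * Re (D t) + v t by rewrite [X in _ + X]mulr1.
    by rewrite -E; exact: dM.
  have t0 := lt_le_trans y0 t1; have [h _ _] := HD t t0.
  have : `|t * Re (D t)| <= v t.
    by apply: le_trans h; rewrite normrM (ger0_norm (ltW t0)) ler_pM2l // Re_le_normc.
  by rewrite ler_norml => /andP[+ _]; lra.
have C0 : 0 <= v 1 by exact: v0.
have du t : 0 < t <= 1 -> `|Im (D t)| <= v 1 / t ^+ 2.
  move=> t01; have /andP[t0 t1] := t01; have [h _ _] := HD t t0.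
  rewrite ler_pdivlMr ?exprn_gt0 // expr2 mulrA mulrC.
  apply: le_trans (yv t t01); rewrite ler_pM2l // mulrC.
  by apply: le_trans h; rewrite ler_pM2l // Im_le_normc.
have inv t : 0 < t -> is_derive t 1 (fun t => - (v 1 / t)) (v 1 / t ^+ 2).
  move=> t0.
  have dI := is_deriveZ (- v 1) (is_deriveV (lt0r_neq0 t0) (is_derive_id t (1 : R))).
  have E : - v 1 *: (- t ^- 2 *: (1 : R)) = v 1 / t ^+ 2.
    by rewrite [(- t ^- 2 *: _)]mulr1 -[LHS]/(- v 1 * - t ^- 2) mulrNN.
  rewrite (_ : (fun t => - (v 1 / t)) = (fun t => - v 1 * t^-1)).
    by rewrite -E; exact: dI.
  by apply/funext => x; rewrite mulNr.
exists (`|u 1| + 2 * v 1) => [|y /andP[y0 y1]]; first by rewrite addr_ge0 // mulr_ge0.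
have u1 : u y - v 1 / y <= u 1 - v 1 / 1.
  apply: (@ge0_is_derive_le _ (fun t => u t - v 1 / t)
    (fun t => - Im (D t) + v 1 / t ^+ 2)) => // t /andP[t1 t2].
    have t0 := lt_le_trans y0 t1; have [_ d _] := HD t t0.
    exact: is_deriveD d (inv t t0).
  have := du t; rewrite (lt_le_trans y0 t1) t2 => /(_ isT).
  by rewrite ler_norml => /andP[_]; lra.
have u2 : - u y - v 1 / y <= - u 1 - v 1 / 1.
  apply: (@ge0_is_derive_le _ (fun t => - u t - v 1 / t)
    (fun t => - - Im (D t) + v 1 / t ^+ 2)) => // t /andP[t1 t2].
    have t0 := lt_le_trans y0 t1; have [_ d _] := HD t t0.
    exact: is_deriveD (is_deriveN d) (inv t t0).
  have := du t; rewrite (lt_le_trans y0 t1) t2 => /(_ isT).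
  by rewrite ler_norml => /andP[+ _]; lra.
have uy : y * `|u y| <= `|u 1| + v 1.
  have E : y * (v 1 / y) = v 1 by rewrite mulrC divfK // lt0r_neq0.
  have B : `|u y| <= `|u 1| + v 1 / y.
    have := ler_norm (u 1); have := ler_norm (- u 1); rewrite normrN divr1 in u1 u2 *.
    by rewrite ler_norml => ? ?; apply/andP; split; lra.
  apply: le_trans (ler_wpM2l (ltW y0) B) _.
  by rewrite mulrDr E lerD2r ler_piMl.
apply: le_trans (ler_wpM2l (ltW y0) (normc_le _)) _.
have := yv y; rewrite y0 y1 => /(_ isT) vy.
rewrite mulrDr -/(u y) -/(v y) (ger0_norm (v0 y y0)); lra.
Qed.

End Pick.

(** * Pick functions near a pole of the factor *)

Section Pole.
Variable R : realType.
Implicit Types (Q S k : R[i] -> R[i]) (z w : R[i]) (s t r y K c d : R).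

Lemma cexp_pihalf s : cexp (s +i* (pi / 2)) = 0 +i* expR s.
Proof.
rewrite /cexp /= cos_pihalf sin_pihalf; apply: complex_eq => /=; ring.
Qed.

Lemma pick_CR Q s t : pick_fun Q -> 0 < sin t ->
  CRat (fun s t => Re (Q (cexp (s +i* t)))) (fun s t => Im (Q (cexp (s +i* t)))) s t.
Proof.
move=> hQ t0; apply: (@holo_CR _ (fun z => Q (cexp z))).
apply: holo_comp; first exact: holo_cexp.
have [|//] := hQ (cexp (s +i* t)).
by rewrite /cexp cImM /= mul0r addr0 mulr_gt0 // expR_gt0.
Qed.

Lemma pick_axis_continuous Q a b : pick_fun Q ->
  seg_continuous (fun s => Im (Q (0 +i* expR s))) a b.
Proof.
move=> hQ s _.
have [|_ h _ _] := CRat_cont (pick_CR (t := pi / 2) s hQ _).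
  by rewrite sin_pihalf.
rewrite (_ : (fun s => _) = (fun s => Im (Q (cexp (s +i* (pi / 2)))))) //.
by apply/funext => x; rewrite cexp_pihalf.
Qed.

Lemma pick_axis_ge0 Q s : pick_fun Q -> 0 <= Im (Q (0 +i* expR s)).
Proof. by move=> hQ; have [] := hQ (0 +i* expR s) (expR_gt0 s). Qed.

(** With [y = e^s], uniform boundedness of the integrals of [Im (Q (i y)) / y] over the
segments [[e^s1, 1]]. *)
Definition log_axis_bounded Q := exists M, forall s1, s1 <= 0 ->
  segint (fun s => Im (Q (0 +i* expR s))) s1 0 <= M.

Lemma log_axis_bounded_near Q s0 M0 : pick_fun Q -> s0 <= 0 ->
  (forall s1, s1 <= s0 -> segint (fun s => Im (Q (0 +i* expR s))) s1 s0 <= M0) ->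
  log_axis_bounded Q.
Proof.
move=> hQ s00 H; set f := (fun s => _) in H *.
have cf a b : seg_continuous f a b := @pick_axis_continuous Q a b hQ.
have f0 a b : 0 <= segint f a b by apply: Rintegral_ge0 => s _; exact: pick_axis_ge0.
exists (M0 + segint f s0 0) => s1 s10; rewrite -/f.
have M00 : 0 <= M0 by apply: le_trans (H s0 (lexx _)).
have [h|h] := leP s1 s0.
  by rewrite (@segint_split _ s0) ?h ?s00 // lerD2r H.
rewrite [in leRHS](@segint_split _ s1) ?(ltW h) ?s10 // addrA lerDr.
by rewrite addr_ge0.
Qed.

Lemma segint_expR a b : a <= b -> segint (@expR R) a b = expR b - expR a.
Proof.
move=> ab; have [E|ne] := eqVneq a b.
  by rewrite E /segint set_itv1 Rintegral_set1 subrr.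
have lt : a < b by rewrite lt_neqAle ne.
rewrite /segint /Rintegral (@continuous_FTC2 R expR expR a b) //.
- by apply: seg_within => x _; exact: continuous_expR.
- split; [by move=> x _; exact: ex_derive|..].
  + by apply: cvg_at_right_filter; exact: continuous_expR.
  + by apply: cvg_at_left_filter; exact: continuous_expR.
- by move=> x _; rewrite derive1E derive_val.
Qed.

(** The factor [S / Q] is [k z / z ^+ m], where [k] takes a real value [c] at [0] and
real values on the real axis, which the last two bounds express. *)
Definition pole_factor Q S k m c K d :=
  [/\ 0 < d, 0 <= K & forall z, 0 < Im z -> normc z < d ->
    [/\ z ^+ m * S z = k z * Q z, normc (k z - c%:C) <= K * normc z &
        `|Im (k z)| <= K * Im z]].

Lemma pole_factor_small Q S k m c K d : c != 0 -> pole_factor Q S k m c K d ->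
  exists d', [/\ pole_factor Q S k m c K d', d' <= 1 & K * d' <= `|c| / 8].
Proof.
move=> c0 [d0 K0 H].
have e0 : 0 < `|c| / 8 / (K + 1) by rewrite !divr_gt0 ?normr_gt0 // ltr_wpDl.
set d1 := Num.min (`|c| / 8 / (K + 1)) 1.
exists (Num.min d d1); split.
- split=> // [|z z0]; first by rewrite !lt_min d0 e0 ltr01.
  by rewrite lt_min => /andP[zd _]; exact: H.
- by rewrite !ge_min lexx !orbT.
- have : Num.min d d1 <= `|c| / 8 / (K + 1) by rewrite !ge_min lexx orbT.
  rewrite ler_pdivlMr ?ltr_wpDl //.
  have : 0 <= Num.min d d1 by rewrite ltW // !lt_min d0 e0 ltr01.
  lra.
Qed.

(** From the growth [|S (i y)| <= C / y], as [Q (i y)] is [(i y) ^+ m.+1 * S (i y)]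
divided by a function that stays away from [0]. *)
Lemma pole_axis_bound Q S k m c K d : c != 0 -> pick_fun S ->
  pole_factor Q S k m.+1 c K d ->
  exists2 s0 : R, s0 <= 0 & exists2 C : R, 0 <= C &
    forall s, s <= s0 -> normc (Q (0 +i* expR s)) <= C * expR s ^+ m.
Proof.
move=> c0 hS /(pole_factor_small c0)[{}d [[d0 K0 H] d1 Kd]].
have [C C0 hC] := pick_growth hS.
exists (ln (d / 2)).
  by apply: ln_le0; lra.
exists (C / (`|c| / 2)); first by rewrite divr_ge0 // divr_ge0.
move=> s hs; set r := expR s.
have r0 : 0 < r by exact: expR_gt0.
have rd : r < d.
  apply: (@le_lt_trans _ _ (d / 2)); last by rewrite ltr_pdivrMr // ltr_pMr // ltr1n.
  by rewrite -[leRHS]lnK ?posrE ?divr_gt0 // ler_expR.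
have nz : normc (0 +i* r) = r by rewrite /= expr0n /= add0r sqrtr_sqr gtr0_norm.
have [|E h1 h2] := H (0 +i* r) r0; first by rewrite nz.
rewrite nz in h1.
have kc : `|c| / 2 <= normc (k (0 +i* r)).
  have := ler_dist_normc c%:C (k (0 +i* r)).
  rewrite normc_real normcB.
  have : K * r <= K * d by apply: ler_wpM2l => //; exact: ltW.
  move: h1 Kd; have := normr_ge0 c; lra.
have cp : 0 < `|c| / 2 by rewrite divr_gt0 // normr_gt0.
rewrite mulrAC ler_pdivlMr //.
apply: (@le_trans _ _ (normc (Q (0 +i* r)) * normc (k (0 +i* r)))).
  by apply: ler_wpM2l kc; exact: normc_ge0.
rewrite -normcM mulrC -E normcM normcX nz exprSr -mulrA mulrC.
apply: ler_wpM2r; first by rewrite exprn_ge0 // ltW.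
by apply: hC; rewrite r0 /= (le_trans (ltW rd)).
Qed.

(** Here [|Q (i e^s)| <= C * e^s], which is integrable up to [s = -oo]. *)
Lemma multiple_pole_bounded Q S k m c K d : c != 0 -> pick_fun Q -> pick_fun S ->
  pole_factor Q S k m.+2 c K d -> log_axis_bounded Q.
Proof.
move=> c0 hQ hS /(pole_axis_bound c0 hS)[s0 s00 [C C0 H]].
apply: (@log_axis_bounded_near Q s0 (C * expR s0)) => // s1 s10.
apply: (@le_trans _ _ (segint (fun s => C * expR s) s1 s0)).
  apply: le_segint; first exact: pick_axis_continuous.
    by apply: segcZ => x _; exact: continuous_expR.
  move=> s /andP[_ hs].
  apply: le_trans (le_trans (ler_norm _) (Im_le_normc _)) _.
  apply: le_trans (H s hs) _; apply: ler_wpM2l => //.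
  rewrite exprS ler_piMr ?expR_ge0 // exprn_ile1 ?expR_ge0 //.
  by rewrite -expR0 ler_expR (le_trans hs).
rewrite segintZ; last by move=> x _; exact: continuous_expR.
rewrite segint_expR //; apply: ler_wpM2l => //.
by rewrite gerBl expR_ge0.
Qed.

End Pole.

Section SimplePole.
Variable R : realType.
Implicit Types (Q S k : R[i] -> R[i]) (z w : R[i]) (s t r y K c d : R).

(** Up to a small error, multiplication by [k z / z] adds [pi - arg z] to the
argument. As it takes [Q z] to another point of the closed upper half-plane,
[arg (Q z) <= arg z] up to a small error, in the first quadrant. The error is at most
proportional to [y], so it does not spoil the bound near the real axis. *)
Lemma simple_pole_sector Q S k c K d x y : c < 0 -> pick_fun Q -> pick_fun S ->
  pole_factor Q S k 1 c K d -> K * d <= - c / 8 ->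
  0 <= x -> 0 < y -> normc (x +i* y) < d ->
  - (Im (Q (x +i* y)) / 4) <= Re (Q (x +i* y)) /\
  (y <= x -> 0 <= Re (Q (x +i* y)) /\
             x * Im (Q (x +i* y)) <= 2 * y * Re (Q (x +i* y))).
Proof.
move=> c0 hQ hS [d0 K0 H] Kd x0 y0 zd.
have [E h1 h2] := H (x +i* y) y0 zd.
have [_ v0] := hQ (x +i* y) y0; have [_ S0] := hS (x +i* y) y0.
have xr : x <= normc (x +i* y) by apply: le_trans (ler_norm _) (Re_le_normc (x +i* y)).
have yr : y <= normc (x +i* y) by apply: le_trans (ler_norm _) (Im_le_normc (x +i* y)).
have Kx : K * x <= - c / 8 by apply: le_trans Kd; apply: ler_wpM2l => //; lra.
have Ky : K * y <= - c / 8 by apply: le_trans Kd; apply: ler_wpM2l => //; lra.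
have {}h1 : normc (k (x +i* y) - c%:C) <= - c / 8.
  by apply: le_trans h1 _; apply: le_trans Kd; apply: ler_wpM2l => //; exact: ltW.
have := le_trans (Re_le_normc _) h1.
rewrite cReB /= ler_norml => /andP[k1 k1'].
move: h2; rewrite /= ler_norml => /andP[k2 k2'].
(* [Im (S z) >= 0], multiplied by the square of the modulus of [z] *)
have key : 0 <= Im (k (x +i* y) * Q (x +i* y) * (x -i* y)).
  have -> : k (x +i* y) * Q (x +i* y) * (x -i* y) = (x ^+ 2 + y ^+ 2)%:C * S (x +i* y).
    rewrite -E expr1 mulrAC; congr (_ * _); apply: complex_eq => /=; ring.
  rewrite cImM /= mul0r addr0; apply: mulr_ge0 => //.
  by rewrite addr_ge0 // sqr_ge0.
move: key; rewrite cImM cReM cImM /=.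
set v := Im (Q _) in v0 *; set u := Re (Q _).
move: k1 k1' k2 k2'; set a := Re (k _); set b := Im (k _) => k1 k1' k2 k2' key.
pose A := b * x - a * y; pose B := a * x + b * y.
have {}key : 0 <= u * A + v * B.
  by apply: le_trans key _; rewrite /A /B le_eqVlt; apply/orP; left; apply/eqP; ring.
have cy : 0 < - c * y by rewrite mulr_gt0 // oppr_gt0.
have bx : `|b * x| <= - c / 8 * y.
  rewrite normrM (ger0_norm x0); apply: (@le_trans _ _ (K * y * x)).
    by apply: ler_wpM2r => //; rewrite ler_norml k2.
  by rewrite mulrAC; apply: ler_wpM2r => //; exact: ltW.
have by_ : `|b * y| <= - c / 8 * y.
  rewrite normrM (ger0_norm (ltW y0)); apply: (@le_trans _ _ (K * y * y)).
    by apply: ler_wpM2r; [exact: ltW|rewrite ler_norml k2].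
  by apply: ler_wpM2r => //; exact: ltW.
have ay1 : 9 / 8 * c * y <= a * y by apply: ler_wpM2r; [exact: ltW|lra].
have ay2 : a * y <= 7 / 8 * c * y by apply: ler_wpM2r; [exact: ltW|lra].
have ax : a * x <= 7 / 8 * c * x by apply: ler_wpM2r => //; lra.
have cx : 0 <= - c * x by rewrite mulr_ge0 // oppr_ge0 ltW.
move: bx by_; rewrite !ler_norml => /andP[bx1 bx2] /andP[by1 by2].
have A1 : 3 / 4 * (- c * y) <= A by rewrite /A; lra.
have A2 : A <= 5 / 4 * (- c * y) by rewrite /A; lra.
have B1 : B <= 1 / 8 * (- c * y) by rewrite /B; lra.
have A0 : 0 < A by apply: lt_le_trans A1; rewrite mulr_gt0 // divr_gt0.
have vB1 : v * B <= v * (1 / 8 * (- c * y)) by apply: ler_wpM2l.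
split.
  rewrite leNgt; apply/negP => un.
  have u0 : u < 0 by lra.
  have uA : u * A <= u * (3 / 4 * (- c * y)) by apply: ler_wnM2l => //; exact: ltW.
  have : u * (- c * y) < - (v / 4) * (- c * y) by rewrite ltr_pM2r.
  have : 0 <= v * (- c * y) by rewrite mulr_ge0 // ltW.
  lra.
move=> yx.
have cyx : - c * y <= - c * x by apply: ler_wpM2l => //; lra.
have B2 : B <= - (3 / 4 * (- c * x)) by rewrite /B; lra.
have vB2 : v * B <= v * - (3 / 4 * (- c * x)) by apply: ler_wpM2l.
have vcx : 0 <= v * (- c * x) by exact: mulr_ge0.
have uA0 : 0 <= u * A by lra.
have u0 : 0 <= u by rewrite -(pmulr_lge0 _ A0).
split => //.
have uA2 : u * A <= u * (5 / 4 * (- c * y)) by apply: ler_wpM2l.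
have u2 : 0 <= u * (- c * y) by rewrite mulr_ge0 // ltW.
have c0' : 0 < - c by rewrite oppr_gt0.
by rewrite -(ler_pM2l c0'); lra.
Qed.

Lemma Im_invN z : Im (- (z + 1)^-1) = Im z / normc (z + 1) ^+ 2.
Proof. by rewrite normc_sqr; case: z => a b /=; rewrite opprK addr0. Qed.

(** The function [P = - 1 / (Q + 1)] is bounded by [2] in the first quadrant near [0],
and its imaginary part is small on rays of small angle. Cauchy's theorem for
[P (exp (s + i t))] bounds the integral of [Im P] on the imaginary axis, and [Im Q]
is at most a constant times [Im P] there. *)
Lemma simple_pole_bounded_lt0 Q S k c K d : c < 0 -> pick_fun Q -> pick_fun S ->
  pole_factor Q S k 1 c K d -> log_axis_bounded Q.
Proof.
move=> c0 hQ hS HH; have cn0 : c != 0 by rewrite lt_eqF.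
have [s1 s10 [C C0 hC]] := pole_axis_bound cn0 hS HH.
have [{HH}d [HH _ Kd]] := pole_factor_small cn0 HH; rewrite ltr0_norm // in Kd.
have [d0 _ _] := HH.
set s0 := Num.min s1 (ln (d / 2)).
have s01 : s0 <= s1 by rewrite ge_min lexx.
have s0d s : s <= s0 -> expR s < d.
  move=> hs; apply: (@le_lt_trans _ _ (d / 2)); last by rewrite ltr_pdivrMr // ltr_pMr // ltr1n.
  rewrite -[leRHS]lnK ?posrE ?divr_gt0 // ler_expR; apply: le_trans hs _.
  by rewrite ge_min lexx orbT.
pose P z := - (Q z + 1)^-1.
have sec s t : s <= s0 -> 0 < sin t -> 0 <= cos t ->
   1 / 2 <= normc (Q (cexp (s +i* t)) + 1) /\
   (sin t <= cos t -> cos t * Im (P (cexp (s +i* t))) <= 2 * sin t).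
  move=> hs st ct.
  have Ez : cexp (s +i* t) = (expR s * cos t) +i* (expR s * sin t).
    by rewrite /cexp; apply: complex_eq => /=; ring.
  have := normc_cexp (s +i* t); rewrite Ez /= -/(normc ((expR s * cos t) +i* (expR s * sin t))) => nz.
  have y0 : 0 < expR s * sin t by rewrite mulr_gt0 // expR_gt0.
  have x0 : 0 <= expR s * cos t by rewrite mulr_ge0 // expR_ge0.
  have zd : normc ((expR s * cos t) +i* (expR s * sin t)) < d by rewrite nz s0d.
  have [u1 u2] := simple_pole_sector c0 hQ hS HH Kd x0 y0 zd.
  have [_ v0] := hQ ((expR s * cos t) +i* (expR s * sin t)) y0.
  move: u1 u2 v0; rewrite /P Im_invN; set q := Q _ => u1 u2 v0.
  split.
    (* if [Im q < 1] then [Re q > - 1 / 4] *)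
    have [v1|v1] := leP 1 (Im q).
      apply: le_trans (Im_le_normc _); rewrite cImD /= addr0 ger0_norm //; lra.
    apply: le_trans (Re_le_normc _); rewrite cReD /=; apply: le_trans (ler_norm _); lra.
  move=> sc; have [|u0 {}u2] := u2; first by rewrite ler_pM2l ?expR_gt0.
  have {}u2 : cos t * Im q <= 2 * sin t * Re q.
    by rewrite -(ler_pM2l (expR_gt0 s)); move: u2; rewrite !mulrA (mulrC 2).
  have n0 : 0 < normc (q + 1) ^+ 2.
    rewrite normc_sqr cReD /= ltr_pwDl ?sqr_ge0 // exprn_gt0 //; lra.
  rewrite mulrA ler_pdivrMr //; apply: le_trans u2 _.
  apply: ler_wpM2l; first by rewrite mulr_ge0 // ltW.
  rewrite normc_sqr cReD /= ler_wpDr ?sqr_ge0 //; nra.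
have CRP s t : s <= s0 -> 0 < sin t -> 0 <= cos t ->
  CRat (fun s t => Re (P (cexp (s +i* t)))) (fun s t => Im (P (cexp (s +i* t)))) s t.
  move=> hs st ct; have [n0 _] := sec s t hs st ct.
  apply: (@holo_CR _ (fun z => P (cexp z))); apply: holo_comp; first exact: holo_cexp.
  apply: holoN; apply: holoV.
    apply: holoD; last exact: holo_cst.
    have [|//] := hQ (cexp (s +i* t)).
    by rewrite /cexp cImM /= mul0r addr0 mulr_gt0 // expR_gt0.
  by rewrite -normc_gt0; apply: lt_le_trans n0; rewrite divr_gt0.
(* a bound for [normc (Q + 1) ^+ 2] on the axis *)
pose L := (C + 1) ^+ 2.
apply: (@log_axis_bounded_near _ Q s0 (L * (2 * pi + 1))) => //.
  exact: le_trans s01 s10.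
move=> s hs.
have l0 : 0 <= s0 - s by rewrite subr_ge0.
have p0 := pi_gt0 R.
(* the lower ray has a small angle [e], on which the integrand is at most [6 * e] *)
have [e [e0 el es [e2 e3 e4]]] : exists e : R, [/\ 0 < e, 6 * e * (s0 - s) <= 1, e <= pi / 2 &
    [/\ 0 < sin e, sin e <= 2 * e & sin e <= cos e /\ 2 / 3 <= cos e]].
  have p3 : 0 < 1 / 3 :> R by rewrite divr_gt0.
  have [d1 d10 H1] := is_derive_approx (is_derive_cos (0 : R)) p3.
  have [d2 d20 H2] := is_derive_approx (is_derive_sin (0 : R)) p3.
  have m0 : 0 < 6 * (s0 - s) + 1 by rewrite ltr_wpDl // mulr_ge0.
  set e := Num.min (Num.min (d1 / 2) (d2 / 2)) (Num.min (1 / 4) (6 * (s0 - s) + 1)^-1).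
  have e0 : 0 < e by rewrite !lt_min !divr_gt0 //= invr_gt0.
  have f1 : e < d1.
    apply: (@le_lt_trans _ _ (d1 / 2)); first by rewrite !ge_min lexx.
    by rewrite ltr_pdivrMr // ltr_pMr // ltr1n.
  have f2 : e < d2.
    apply: (@le_lt_trans _ _ (d2 / 2)); first by rewrite !ge_min lexx !orbT.
    by rewrite ltr_pdivrMr // ltr_pMr // ltr1n.
  have f3 : e <= 1 / 4 by rewrite !ge_min lexx !orbT.
  have f4 : e * (6 * (s0 - s) + 1) <= 1.
    by rewrite -ler_pdivlMr // mul1r !ge_min lexx !orbT.
  clearbody e; exists e.
  have := H1 e; rewrite gtr0_norm // => /(_ f1).
  rewrite add0r cos0 sin0 oppr0 mul0r subr0 ler_norml => /andP[c1 _].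
  have := H2 e; rewrite gtr0_norm // => /(_ f2).
  rewrite add0r sin0 cos0 mul1r subr0 ler_norml => /andP[g1 g2].
  have p2 := pi_ge2 R.
  by split; [|lra|lra|split; [lra|lra|split; lra]].
have st t : e <= t <= pi / 2 -> 0 < sin t /\ 0 <= cos t.
  move=> /andP[t1 t2]; split.
    by apply: sin_gt0_pi; apply/andP; split; lra.
  by apply: cos_ge0_pihalf; apply/andP; split; lra.
have ep : e <= e <= pi / 2 by apply/andP; split; lra.
have pp : e <= (pi / 2 : R) <= (pi / 2 : R) by apply/andP; split; lra.
pose U s t := Re (P (cexp (s +i* t))); pose V s t := Im (P (cexp (s +i* t))).
have RC : rectCR V (fun s t => - U s t) s s0 e (pi / 2).
  move=> s' t' /andP[_ hs'] /st[h1 h2]; apply: CRat_rot.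
  exact: CRP.
have G := goursat hs es RC.
have cV t : e <= t <= pi / 2 -> seg_continuous (V ^~ t) s s0.
  by move=> ht s' hs'; have [] := CRat_cont (RC s' t hs' ht).
have cU s' : s <= s' <= s0 -> seg_continuous (fun t => - U s' t) e (pi / 2).
  by move=> hs' t ht; have [] := CRat_cont (RC s' t hs' ht).
have U2 s' t : s <= s' <= s0 -> e <= t <= pi / 2 -> `|U s' t| <= 2.
  move=> /andP[_ hs'] /st[h1 h2]; have [n1 _] := sec s' t hs' h1 h2.
  apply: le_trans (Re_le_normc _) _; rewrite normcN normcV invf_ple ?posrE //.
    by apply: le_trans n1; lra.
  by apply: lt_le_trans n1; lra.
(* the two vertical sides: an integrand of modulus at most [4] on a length at most [pi / 2] *)
have vertical_sides : - pi * 2 <= segint (fun t => - U s0 t - - U s t) e (pi / 2).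
  apply: (@le_trans _ _ (segint (fun=> - 4) e (pi / 2))).
    rewrite segint_cst //; have := e0; lra.
  apply: le_segint; first exact: segc_cst.
    by apply: segcB; apply: cU; rewrite ?lexx ?hs.
  move=> t ht.
  have := U2 s t; rewrite lexx hs => /(_ isT ht); rewrite ler_norml => /andP[h1 h2].
  have := U2 s0 t; rewrite lexx hs => /(_ isT ht); rewrite ler_norml => /andP[h3 h4].
  lra.
have low_ray : segint (V ^~ e) s s0 <= 1.
  apply: le_trans el; rewrite -segint_cst //.
  apply: le_segint; [exact: cV|exact: segc_cst|].
  move=> s' /andP[_ hs']; have [h1 h2] := st e ep; have [_ /(_ e4.1)] := sec s' e hs' h1 h2.
  rewrite -/(V s' e) => h.
  have c23 := e4.2.
  have [V0|V0] := leP (V s' e) 0; first by apply: le_trans V0 _; rewrite mulr_ge0 // ltW.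
  have : 2 / 3 * V s' e <= cos e * V s' e by apply: ler_wpM2r => //; exact: ltW.
  lra.
have main : segint (V ^~ (pi / 2)) s s0 <= 2 * pi + 1.
  move: G; rewrite segintB; [|by apply: cV..]; lra.
have L0 : 0 <= L by exact: sqr_ge0.
apply: le_trans (ler_wpM2l L0 main).
rewrite -segintZ; last exact: cV.
apply: le_segint; first exact: pick_axis_continuous.
  by apply: segcZ; exact: cV.
move=> s' /andP[_ hs']; rewrite /V cexp_pihalf /P Im_invN mulrCA.
have [h1 h2] := st _ pp; have [n1 _] := sec s' _ hs' h1 h2.
rewrite cexp_pihalf in n1.
set q := Q _ in n1 *.
have q0 : 0 <= Im q by exact: pick_axis_ge0.
have n0 : 0 < normc (q + 1) by apply: lt_le_trans n1; lra.
rewrite -[leLHS]mulr1; apply: ler_wpM2l => //.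
rewrite ler_pdivlMr ?exprn_gt0 // mul1r ler_pXn2r ?nnegrE ?addr_ge0 ?normc_ge0 //.
apply: le_trans (le_normcD _ _) _; rewrite normc1 lerD2r.
by have := hC s' (le_trans hs' s01); rewrite expr0 mulr1.
Qed.

Lemma holo_conj f z : holo f (conjc z) -> holo (fun w => conjc (f (conjc w))) z.
Proof.
move=> [p cp E]; exists (fun w => conjc (p (conjc w))).
  move=> e /cp[d d0 H]; exists d => // w wd.
  by rewrite -conjcB normc_conj; apply: H; rewrite -conjcB normc_conj.
by move=> w; rewrite -conjcB E conjcM conjcB !conjcK.
Qed.

(** Reflection of the half-plane in the imaginary axis. *)
Lemma pick_reflect Q : pick_fun Q -> pick_fun (fun z => - conjc (Q (- conjc z))).
Proof.
move=> hQ z z0; have Em : Im (- conjc z) = Im z by case: (z) => a b /=; rewrite opprK.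
have [|h h0] := hQ (- conjc z); first by rewrite Em.
split; last by move: h0; case: (Q _) => a b /=; rewrite opprK.
apply: holoN; apply: (@holo_conj (fun w => Q (- w))).
by apply: (@holo_comp _ -%R) => //; apply: holoN; exact: holo_id.
Qed.

Lemma pole_factor_reflect Q S k c K d : pole_factor Q S k 1 c K d ->
  pole_factor (fun z => - conjc (Q (- conjc z))) (fun z => - conjc (S (- conjc z)))
    (fun z => - conjc (k (- conjc z))) 1 (- c) K d.
Proof.
move=> [d0 K0 H]; split=> // z z0 zd.
have Em : Im (- conjc z) = Im z by case: (z) => a b /=; rewrite opprK.
have En : normc (- conjc z) = normc z by rewrite normcN normc_conj.
have [||E h1 h2] := H (- conjc z); [by rewrite Em|by rewrite En|].
rewrite Em En in h1 h2; split.
- have := congr1 conjc E; rewrite !expr1 !conjcM conjcN conjcK => {}E.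
  by rewrite mulrNN -E mulrN mulNr.
- apply: le_trans h1; rewrite le_eqVlt; apply/orP; left; apply/eqP.
  rewrite -[LHS]normcN -[RHS]normc_conj; congr normc.
  by case: (k _) => a b; apply: complex_eq => /=; ring.
- by move: h2; case: (k _) => a b /=; rewrite opprK.
Qed.

Lemma simple_pole_bounded Q S k c K d : c != 0 -> pick_fun Q -> pick_fun S ->
  pole_factor Q S k 1 c K d -> log_axis_bounded Q.
Proof.
move=> cn0 hQ hS HH; have [c0|c0] := ltP c 0; first exact: simple_pole_bounded_lt0 HH.
have {}c0 : - c < 0 by rewrite oppr_lt0 lt_neqAle eq_sym cn0.
have [M HM] := simple_pole_bounded_lt0 c0 (pick_reflect hQ) (pick_reflect hS) (pole_factor_reflect HH).
exists M => s1 /HM; congr (_ <= _); apply: eq_segint => s _.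
have -> : - conjc (0 +i* expR s) = 0 +i* expR s.
  by apply: complex_eq => /=; rewrite ?oppr0 ?opprK.
by case: (Q _) => a b /=; rewrite opprK.
Qed.

Lemma pole_bounded Q S k m c K d : (0 < m)%N -> c != 0 -> pick_fun Q -> pick_fun S ->
  pole_factor Q S k m c K d -> log_axis_bounded Q.
Proof.
case: m => [//|[|m]] _ c0 hQ hS; first exact: simple_pole_bounded.
exact: multiple_pole_bounded.
Qed.

End SimplePole.

(** * Poles and zeros of a rational factor *)

Section PolyLipschitz.
Variable R : realType.
Implicit Types (p q A B : {poly R[i]}) (z w : R[i]).

Lemma poly_lipschitz p : exists2 L : R, 0 <= L & forall z w,
  normc z <= 1 -> normc w <= 1 -> normc (p.[z] - p.[w]) <= L * normc (z - w).
Proof.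
elim/poly_ind: p => [|p c [L L0 H]].
  by exists 0 => // z w _ _; rewrite !horner0 subrr normc0 mul0r.
exists (L + (normc p.[0] + L)); first by rewrite !addr_ge0 // normc_ge0.
move=> z w z1 w1; rewrite !hornerMXaddC.
rewrite (_ : _ - _ = (p.[z] - p.[w]) * z + p.[w] * (z - w)); last by ring.
apply: le_trans (le_normcD _ _) _; rewrite !normcM mulrDl; apply: lerD.
  apply: le_trans (H z w z1 w1); rewrite ler_piMr ?normc_ge0 //.
apply: ler_wpM2r; first exact: normc_ge0.
have := H w 0 w1; rewrite normc0 ler01 => /(_ isT).
rewrite subr0 => h; rewrite -(subrK p.[0] p.[w]) addrC.
apply: le_trans (le_normcD _ _) _; rewrite lerD2l; apply: le_trans h _.
by rewrite ler_piMr.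
Qed.

Lemma poly_near_neq0 p : p.[0] != 0 -> exists2 d : R, 0 < d & d <= 1 /\
  forall z, normc z < d -> normc p.[0] / 2 <= normc p.[z].
Proof.
move=> p0; have [L L0 H] := poly_lipschitz p.
have n0 : 0 < normc p.[0] by rewrite normc_gt0.
have L1 : 0 < L + 1 by rewrite ltr_wpDl.
exists (Num.min 1 (normc p.[0] / 2 / (L + 1))).
  by rewrite lt_min ltr01 !divr_gt0.
split; first by rewrite ge_min lexx.
move=> z; rewrite lt_min => /andP[z1 z2].
have := H 0 z; rewrite normc0 ler01 (ltW z1) sub0r normcN => /(_ isT isT) h.
have : L * normc z <= normc p.[0] / 2.
  move: z2; rewrite ltr_pdivlMr // mulrC => /ltW; apply: le_trans.
  by apply: ler_wpM2r; [exact: normc_ge0|rewrite lerDl].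
have := ler_dist_normc p.[0] p.[z]; lra.
Qed.

Lemma poly_disc_bounded p : exists2 M : R, 0 <= M & forall z, normc z <= 1 -> normc p.[z] <= M.
Proof.
have [L L0 H] := poly_lipschitz p.
exists (normc p.[0] + L); first by rewrite addr_ge0 // normc_ge0.
move=> z z1; have := H z 0 z1; rewrite normc0 ler01 subr0 => /(_ isT) h.
have := le_normcD (p.[z] - p.[0]) p.[0]; rewrite subrK.
have : L * normc z <= L by rewrite ler_piMr.
lra.
Qed.

(** The quotient [k = A / B] is Lipschitz near [0]. As [k (conjc z)] is the conjugate of
[k z], the Lipschitz bound for [z] and [conjc z] reads [`|Im (k z)| <= K * Im z]. The
symmetry is assumed outside [0], where the powers of [z] cancel; at
[0] it follows by continuity. *)
Lemma rational_pole_bounded (Q S : R[i] -> R[i]) A B m (d : R) : (0 < m)%N ->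
  A.[0] != 0 -> B.[0] != 0 -> 0 < d -> pick_fun Q -> pick_fun S ->
  (forall z, 0 < Im z -> normc z < d -> z ^+ m * B.[z] * S z = A.[z] * Q z) ->
  (forall z, z != 0 -> A.[conjc z] * conjc B.[z] = conjc A.[z] * B.[conjc z]) ->
  log_axis_bounded Q.
Proof.
move=> m0 A0 B0 d0 hQ hS E sym.
pose k z := A.[z] / B.[z].
have [d1 d10 [d11 hB]] := poly_near_neq0 B0.
set b := normc B.[0] / 2 in hB.
have b0 : 0 < b by rewrite divr_gt0 // normc_gt0.
have Bn z : normc z < d1 -> B.[z] != 0.
  by move=> /hB h; rewrite -normc_gt0; apply: lt_le_trans h.
have [LA LA0 hLA] := poly_lipschitz A; have [LB LB0 hLB] := poly_lipschitz B.
have [MA MA0 hMA] := poly_disc_bounded A; have [MB MB0 hMB] := poly_disc_bounded B.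
pose K := (LA * MB + MA * LB) / b ^+ 2.
have K0 : 0 <= K by rewrite divr_ge0 ?sqr_ge0 // addr_ge0 // mulr_ge0.
have lip z w : normc z < d1 -> normc w < d1 -> normc (k z - k w) <= K * normc (z - w).
  move=> hz hw; have Bz := Bn z hz; have Bw := Bn w hw.
  have z1 : normc z <= 1 by apply: le_trans d11; exact: ltW.
  have w1 : normc w <= 1 by apply: le_trans d11; exact: ltW.
  have -> : k z - k w = ((A.[z] - A.[w]) * B.[w] - A.[w] * (B.[z] - B.[w])) / (B.[z] * B.[w]).
    by rewrite /k; field; rewrite Bz Bw.
  rewrite normcM normcV /K mulrAC; apply: ler_pM; rewrite ?invr_ge0 ?normc_ge0 //.
    apply: le_trans (le_normcB _ _) _; rewrite !normcM mulrDl; apply: lerD.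
      by rewrite mulrAC; apply: ler_pM; rewrite ?normc_ge0 ?hLA ?hMB.
    by rewrite -mulrA; apply: ler_pM; rewrite ?normc_ge0 ?hLB ?hMA.
  rewrite lef_pV2 ?posrE ?exprn_gt0 ?normc_gt0 ?mulf_neq0 //.
  by rewrite normcM expr2; apply: ler_pM; rewrite ?(ltW b0) ?hB.
have sym_k z : z != 0 -> normc z < d1 -> k (conjc z) = conjc (k z).
  move=> z0 hz; have Bz := Bn z hz.
  have Bz' : B.[conjc z] != 0 by apply: Bn; rewrite normc_conj.
  apply: (mulIf Bz'); rewrite divfK // /k conjcM.
  have Bc : conjc B.[z] != 0 by rewrite conjc_eq0.
  apply: (mulIf Bc); rewrite sym //.
  have -> : conjc (B.[z])^-1 = (conjc B.[z])^-1 by exact: conjc_inv.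
  by field.
have k0 : k 0 = (Re (k 0))%:C.
  apply: complex_eq => //=; apply/eqP; rewrite -normr_le0; apply/ler_addgt0Pr => e e0.
  rewrite add0r.
  set t := Num.min (d1 / 2) (e / (K + 1)).
  have t0 : 0 < t by rewrite lt_min !divr_gt0 // ltr_wpDl.
  have td : t < d1.
    apply: (@le_lt_trans _ _ (d1 / 2)); first by rewrite ge_min lexx.
    by rewrite ltr_pdivrMr // ltr_pMr // ltr1n.
  have te : K * t <= e.
    have : t <= e / (K + 1) by rewrite ge_min lexx orbT.
    rewrite ler_pdivlMr ?ltr_wpDl //; lra.
  have nt : normc t%:C = t by rewrite normc_real ger0_norm // ltW.
  have real_t : Im (k t%:C) = 0.
    have := sym_k t%:C; rewrite realc_neq0 ?lt0r_neq0 // nt td => /(_ isT isT).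
    rewrite conjc_real; case: (k _) => x y [] /= /eqP; rewrite -subr_eq0 opprK.
    by rewrite -mulr2n mulrn_eq0 /= => /eqP.
  apply: le_trans te; rewrite -(subr0 (Im (k 0))) -real_t -cImB.
  apply: le_trans (Im_le_normc _) _; apply: le_trans (lip _ _ _ _) _; rewrite ?normc0 ?nt //.
  by rewrite sub0r normcN nt.
have c0 : Re (k 0) != 0.
  have : k 0 != 0 by rewrite /k mulf_neq0 // invr_eq0.
  by rewrite k0; apply: contraNneq => ->.
apply: (@pole_bounded _ Q S k m (Re (k 0)) K (Num.min d d1)) => //.
split => // [|z z0]; first by rewrite lt_min d0.
rewrite lt_min => /andP[zd zd1].
have zn0 : z != 0 by apply: contraTneq z0 => ->; rewrite /= ltxx.
have Bz := Bn z zd1.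
split.
- apply: (mulIf Bz); rewrite mulrAC E // /k; by field.
- by rewrite -k0 -[leRHS]mulrC -[X in normc X * _]subr0 mulrC; apply: lip; rewrite ?normc0.
- have h := lip z (conjc z) zd1; rewrite normc_conj in h; have {}h := h zd1.
  rewrite sym_k // in h.
  have E2 x : normc (x - conjc x) = 2 * `|Im x|.
    case: x => x y /=; rewrite subrr expr0n /= add0r opprK sqrtr_sqr -mulr2n normrMn; ring.
  by rewrite !E2 in h; rewrite (gtr0_norm z0) in h; lra.
Qed.

End PolyLipschitz.

Section FactorPole.
Variable R : realType.
Implicit Types (p q : {poly R[i]}) (Q S : R[i] -> R[i]) (z w : R[i]).

Lemma conjcX z n : conjc (z ^+ n) = conjc z ^+ n.
Proof.
elim: n => [|n IH]; last by rewrite !exprS conjcM IH.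
by rewrite !expr0; apply: complex_eq => /=; rewrite ?oppr0.
Qed.

Lemma pick_shift Q (x : R) : pick_fun Q -> pick_fun (fun z => Q (z + x%:C)).
Proof.
move=> hQ z z0; have [|h h0] := hQ (z + x%:C); first by rewrite cImD /= addr0.
split => //; apply: holo_comp => //.
by apply: holoD; [exact: holo_id|exact: holo_cst].
Qed.

Lemma uhp_neq0 z : 0 < Im z -> z != 0.
Proof. by move=> z0; apply: contraTneq z0 => ->; rewrite /= ltxx. Qed.

Lemma Im_oppV z : z != 0 -> Im (- z^-1) = Im z / normc z ^+ 2.
Proof. by rewrite normc_sqr; case: z => a b _ /=; rewrite opprK. Qed.

Lemma pick_inversion Q : pick_fun Q -> pick_fun (fun z => Q (- z^-1)).
Proof.
move=> hQ z z0; have zn0 := uhp_neq0 z0.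
have [|h h0] := hQ (- z^-1).
  by rewrite Im_oppV // divr_gt0 // exprn_gt0 // normc_gt0.
split => //; apply: holo_comp => //.
by apply: holoN; apply: holoV => //; exact: holo_id.
Qed.

(** The relation [S = (p / q) * Q] with a symmetric factor, in a form where the
exchange of poles and zeros is the exchange of [(p, Q)] with [(q, S)]. *)
Definition factor_rel p q Q S :=
  (forall z, 0 < Im z -> p.[z] != 0 -> q.[z] != 0 -> q.[z] * S z = p.[z] * Q z) /\
  (forall z, p.[conjc z] * conjc q.[z] = conjc p.[z] * q.[conjc z]).

Lemma factor_rel_sym p q Q S : factor_rel p q Q S -> factor_rel q p S Q.
Proof.
move=> [h1 h2]; split=> [z z0 nq np|z]; first by rewrite h1.
by rewrite mulrC -h2 mulrC.
Qed.

Lemma poly_near_unit p : p.[0] != 0 -> exists2 d : R, 0 < d &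
  forall z, normc z < d -> p.[z] != 0.
Proof.
move=> p0; have [d d0 [_ h]] := poly_near_neq0 p0; exists d => // z /h hz.
by rewrite -normc_gt0; apply: lt_le_trans hz; rewrite divr_gt0 // normc_gt0.
Qed.

Lemma finite_pole_bounded p q Q S (x : R) : pick_fun Q -> pick_fun S ->
  factor_rel p q Q S -> q != 0 -> coprimep p q -> root q x%:C ->
  log_axis_bounded (fun z => Q (z + x%:C)).
Proof.
move=> hQ hS [E sym] q0 cop rq.
have px : p.[x%:C] != 0 by apply: coprimep_root rq; rewrite coprimep_sym.
have [m [q1]] := multiplicity_XsubC q x%:C.
rewrite q0 /= => q1x Eq.
have m0 : (0 < m)%N.
  by case: m Eq => // Eq; move: rq; rewrite Eq expr0 mulr1 (negbTE q1x).
set A := p \Po ('X + x%:C%:P); set B := q1 \Po ('X + x%:C%:P).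
have EA z : A.[z] = p.[z + x%:C] by rewrite /A horner_comp hornerD hornerX hornerC.
have EB z : q.[z + x%:C] = B.[z] * z ^+ m.
  rewrite /B horner_comp hornerD hornerX hornerC Eq hornerM horner_exp.
  by rewrite hornerXsubC addrK.
have A0 : A.[0] != 0 by rewrite EA add0r.
have B0 : B.[0] != 0 by rewrite /B horner_comp hornerD hornerX hornerC add0r.
have [d1 d10 h1] := poly_near_unit A0; have [d2 d20 h2] := poly_near_unit B0.
apply: (@rational_pole_bounded _ _ (fun z => S (z + x%:C)) A B m (Num.min d1 d2)) => //.
- by rewrite lt_min d10.
- exact: pick_shift.
- exact: pick_shift.
- move=> z z0; rewrite lt_min => /andP[/h1 zA /h2 zB].
  rewrite (mulrC (z ^+ m)) -EB EA; apply: E.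
  + by rewrite cImD /= addr0.
  + by rewrite -EA.
  + by rewrite EB mulf_neq0 // expf_neq0 // uhp_neq0.
- move=> z z0.
  have cz : conjc z ^+ m != 0 by rewrite expf_neq0 // conjc_eq0.
  apply: (mulIf cz); rewrite -mulrA -[X in _ * (_ * X)]conjcX -conjcM -EB.
  rewrite -[RHS]mulrA -EB !EA.
  have Ec : conjc (z + x%:C) = conjc z + x%:C.
    by case: (z) => a b; apply: complex_eq => /=; ring.
  by rewrite -Ec sym.
Qed.

(** [z ^+ n * p.[- z^-1]] for the degree [n] of [p]. *)
Definition invert_poly p : {poly R[i]} :=
  \poly_(j < size p) (p`_((size p).-1 - j) * (-1) ^+ ((size p).-1 - j)).

Lemma invert_poly0 p : p != 0 -> (invert_poly p).[0] != 0.
Proof.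
move=> p0; rewrite horner_coef0 coef_poly size_poly_gt0 p0 subn0.
by rewrite mulf_neq0 ?signr_eq0 // -lead_coefE lead_coef_eq0.
Qed.

Lemma invert_polyE p z : p != 0 -> z != 0 ->
  (invert_poly p).[z] = z ^+ (size p).-1 * p.[- z^-1].
Proof.
move=> p0 z0; rewrite horner_poly horner_coef mulr_sumr.
rewrite (reindex_inj rev_ord_inj); apply: eq_bigr => i _ /=.
have hi : (i <= (size p).-1)%N by rewrite -ltnS prednK ?size_poly_gt0.
have -> : (size p - i.+1 = (size p).-1 - i)%N.
  by rewrite -[X in (X - _)%N](prednK (n := size p)) ?size_poly_gt0 ?subSS.
have -> : z ^+ (size p).-1 = z ^+ ((size p).-1 - i) * z ^+ i by rewrite -exprD subnK.
have zi : z ^+ i != 0 by rewrite expf_neq0.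
rewrite subKn // (exprNn z^-1) exprVn; field.
exact: zi.
Qed.

Lemma infinite_pole_bounded p q Q S : pick_fun Q -> pick_fun S ->
  factor_rel p q Q S -> p != 0 -> q != 0 -> (size q < size p)%N ->
  log_axis_bounded (fun z => Q (- z^-1)).
Proof.
move=> hQ hS [E sym] p0 q0 sz.
have A0 := invert_poly0 p0; have B0 := invert_poly0 q0.
have [d1 d10 h1] := poly_near_unit A0; have [d2 d20 h2] := poly_near_unit B0.
have sq : (0 < size q)%N by rewrite size_poly_gt0.
have Es : ((size p).-1 = (size p - size q) + (size q).-1)%N by lia.
apply: (@rational_pole_bounded _ _ (fun z => S (- z^-1)) (invert_poly p) (invert_poly q)
  (size p - size q) (Num.min d1 d2)) => //.
- by rewrite subn_gt0.
- by rewrite lt_min d10.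
- exact: pick_inversion.
- exact: pick_inversion.
- move=> z z0; rewrite lt_min => /andP[/h1 zA /h2 zB].
  have zn0 := uhp_neq0 z0.
  move: zA zB; rewrite !invert_polyE // => zA zB.
  rewrite Es exprD -!mulrA; congr (_ * _).
  rewrite E //.
  + by rewrite Im_oppV // divr_gt0 // exprn_gt0 // normc_gt0.
  + by move: zA; rewrite mulf_eq0 negb_or => /andP[].
  + by move: zB; rewrite mulf_eq0 negb_or => /andP[].
- move=> z zn0; have cz : conjc z != 0 by rewrite conjc_eq0.
  rewrite !invert_polyE // !conjcM !conjcX.
  have Ec : - (conjc z)^-1 = conjc (- z^-1).
    by rewrite conjcN; congr (- _); exact: esym (conjc_inv z).
  have := sym (- z^-1); rewrite -Ec => h.
  rewrite mulrACA h; ring.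
Qed.

End FactorPole.

(** * The Kac-Donoghue integrals *)

Section KacDonoghue.
Variable R : realType.
Implicit Types (f : R -> R) (Q S : R[i] -> R[i]).

Lemma cvg_union_integral_le f (F : nat -> set R) (M : R) :
  {homo F : n m / (n <= m)%N >-> (n <= m)%O} ->
  (forall n, measurable (F n)) -> (forall n, measurable_fun (F n) f) ->
  (forall n x, F n x -> 0 <= f x) ->
  (forall n, (\int[@lebesgue_measure R]_(x in F n) (f x)%:E <= M%:E)%E) ->
  (\int[@lebesgue_measure R]_(x in \bigcup_n F n) (f x)%:E < +oo)%E.
Proof.
move=> nd mF mf f0 H; apply: (@le_lt_trans _ _ M%:E); last exact: ltry.
have L : (\int[lebesgue_measure]_(x in F i) (f x)%:E)%E @[i --> \oo] -->
    (\int[lebesgue_measure]_(x in \bigcup_i F i) (f x)%:E)%E.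
  apply: ge0_nondecreasing_set_cvg_integral => //.
  by move=> n; apply/measurable_EFinP; exact: mf.
have <- := cvg_lim (@ereal_hausdorff R) L.
by apply: (lime_le (cvgP _ L)); apply: nearW => n; exact: H.
Qed.

Lemma subst_expR f (a b : R) : a <= b -> (forall y, 0 < y -> {for y, continuous f}) ->
  (\int[@lebesgue_measure R]_(y in `[expR a, expR b]) (f y / y)%:E =
   \int[@lebesgue_measure R]_(s in `[a, b]) (f (expR s))%:E)%E.
Proof.
move=> ab cf.
have D : derive1 (@expR R) = @expR R by apply/funext => x; rewrite derive1E derive_val.
rewrite (@integration_by_substitution_increasing R expR (fun y => f y / y) a b) //.
- apply: eq_integral => x _; congr EFin; rewrite D.
  by rewrite -[LHS]/(f (expR x) / expR x * expR x) divfK // gt_eqF // expR_gt0.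
- by move=> x y _ _; rewrite ltr_expR.
- by rewrite D => x _; exact: continuous_expR.
- by rewrite D; apply/cvg_ex; exists (expR a); apply: cvg_at_right_filter; exact: continuous_expR.
- by rewrite D; apply/cvg_ex; exists (expR b); apply: cvg_at_left_filter; exact: continuous_expR.
- split; [by move=> x _; exact: ex_derive|..].
  + by apply: cvg_at_right_filter; exact: continuous_expR.
  + by apply: cvg_at_left_filter; exact: continuous_expR.
- apply: seg_within => y /andP[y1 _].
  have y0 : 0 < y by apply: lt_le_trans y1; exact: expR_gt0.
  apply: continuousM; first exact: cf.
  by apply: continuousV; [rewrite gt_eqF|exact: cvg_id].
Qed.

Lemma segint_EFin f (a b : R) : seg_continuous f a b ->
  (\int[@lebesgue_measure R]_(s in `[a, b]) (f s)%:E = (segint f a b)%:E)%E.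
Proof.
move=> cf; rewrite /segint /Rintegral fineK //.
by apply: integrable_fin_num => //; exact: seg_integrable.
Qed.

Lemma div_measurable f (a b : R) : 0 < a -> (forall y, 0 < y -> {for y, continuous f}) ->
  measurable_fun `[a, b] (fun y => f y / y).
Proof.
move=> a0 cf; apply: subspace_continuous_measurable_fun => //.
apply: seg_within => y /andP[y1 _]; have y0 := lt_le_trans a0 y1.
apply: continuousM; first exact: cf.
by apply: continuousV; [rewrite gt_eqF|exact: cvg_id].
Qed.

Lemma pick_vertical_continuous Q (x y : R) : pick_fun Q -> 0 < y ->
  {for y, continuous (fun y => Im (Q (x +i* y)))}.
Proof.
move=> hQ y0; have [h _] := hQ (x +i* y) y0.
by have [_ _ _] := CRat_cont (holo_CR h).
Qed.

Lemma nevanlinna_pick Q : nevanlinna Q -> pick_fun Q.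
Proof.
move=> [_ hQ Q0] z z0; have zn : @nonreal R z by rewrite /nonreal /= gt_eqF.
split; first exact: derivable_holo (hQ z zn).
by rewrite -(divfK (lt0r_neq0 z0) (Im (Q z))) mulr_ge0 ?Q0 // ltW.
Qed.

Lemma kac_donoghue_finite Q (x : R) : nevanlinna Q ->
  log_axis_bounded (fun z => Q (z + x%:C)) -> kac_donoghue (Some x) Q.
Proof.
move=> nQ [M HM]; split=> //; have hQ := nevanlinna_pick nQ.
have EF : `]0%R, 1%R]%classic = \bigcup_n `[expR (- n%:R), 1%R]%classic :> set R.
  apply/seteqP; split=> y /=.
    rewrite in_itv /= => /andP[y0 y1]; exists (Num.truncn (- ln y)).+1 => //=.
    rewrite in_itv /= y1 andbT -[leRHS]lnK // ler_expR lerNl.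
    by rewrite ltW // truncnS_gt.
  move=> [n _] /=; rewrite !in_itv /= => /andP[y1 ->]; rewrite andbT.
  by apply: lt_le_trans y1; exact: expR_gt0.
rewrite EF.
have cf y : 0 < y -> {for y, continuous (fun y => Im (Q (x +i* y)))}.
  exact: pick_vertical_continuous.
apply: (@cvg_union_integral_le (fun y => Im (Q (x +i* y)) / y) _ M).
- move=> n m nm; rewrite subsetEset => y /=; rewrite !in_itv /= => /andP[h ->].
  by rewrite andbT; apply: le_trans h; rewrite ler_expR lerN2 ler_nat.
- by move=> n; exact: measurable_itv.
- by move=> n; apply: div_measurable => //; exact: expR_gt0.
- move=> n y /=; rewrite in_itv /= => /andP[y1 _].
  have y0 : 0 < y by apply: lt_le_trans y1; exact: expR_gt0.
  by rewrite divr_ge0 ?(ltW y0) //; have [] := hQ (x +i* y) y0.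
- move=> n; rewrite -[X in `[_, X]](expR0 R).
  have n0 : - n%:R <= 0 :> R by rewrite oppr_le0.
  rewrite subst_expR //.
  have E s : x +i* expR s = (0 +i* expR s) + x%:C.
    by apply: complex_eq => /=; ring.
  under eq_integral do rewrite E.
  rewrite (segint_EFin (f := fun s => Im (Q ((0 +i* expR s) + x%:C)))) ?lee_fin ?HM //.
  exact: pick_axis_continuous (pick_shift x hQ).
Qed.

Lemma kac_donoghue_infinite Q : nevanlinna Q ->
  log_axis_bounded (fun z => Q (- z^-1)) -> kac_donoghue None Q.
Proof.
move=> nQ [M HM]; split=> //; have hQ := nevanlinna_pick nQ.
have EF : `[1%R, +oo[%classic = \bigcup_n `[1%R, expR n%:R]%classic :> set R.
  apply/seteqP; split=> y /=.
    rewrite in_itv /= andbT => y1; exists (Num.truncn (ln y)).+1 => //=.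
    have y0 : 0 < y by exact: lt_le_trans y1.
    rewrite in_itv /= y1 /= -[leLHS]lnK // ler_expR.
    by rewrite ltW // truncnS_gt.
  by move=> [n _] /=; rewrite !in_itv /= => /andP[-> _].
rewrite EF.
have cf y : 0 < y -> {for y, continuous (fun y => Im (Q (0 +i* y)))}.
  exact: pick_vertical_continuous.
apply: (@cvg_union_integral_le (fun y => Im (Q (0 +i* y)) / y) _ M).
- move=> n m nm; rewrite subsetEset => y /=; rewrite !in_itv /= => /andP[-> h].
  by apply: le_trans h _; rewrite ler_expR ler_nat.
- by move=> n; exact: measurable_itv.
- by move=> n; exact: div_measurable.
- move=> n y /=; rewrite in_itv /= => /andP[y1 _].
  have y0 : 0 < y by exact: lt_le_trans y1.
  by rewrite divr_ge0 ?(ltW y0) //; have [] := hQ (0 +i* y) y0.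
- move=> n; rewrite -[X in `[X, _]](expR0 R) subst_expR //.
  have n0 : - n%:R <= 0 :> R by rewrite oppr_le0.
  have := @integration_by_substitution_oppr R (fun s => Im (Q (0 +i* expR s))) (- n%:R) 0 n0.
  rewrite oppr0 opprK => ->; last by apply: seg_within; exact: pick_axis_continuous.
  have E s : 0 +i* expR (- s) = - (0 +i* expR s)^-1 :> R[i].
    rewrite expRN; apply: complex_eq; rewrite /= ?mul0r ?oppr0 // opprK expr0n /= add0r.
    by rewrite expr2 invfM mulrA mulfV ?mul1r // gt_eqF // expR_gt0.
  under eq_integral do rewrite /= E.
  rewrite (segint_EFin (f := fun s => Im (Q (- (0 +i* expR s)^-1)))) ?lee_fin ?HM //.
  exact: pick_axis_continuous (pick_inversion hQ).
Qed.

(** At a pole [z] of [r], the point [conjc z] is a pole too, and both sides of the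
symmetry relation vanish. *)
Lemma ratfun_factor_rel (r : ratfun R) Q S : ratfun_symmetric r ->
  (forall z, nonreal z -> ~~ finite_pole r z -> S z = ratfun_eval r z * Q z) ->
  factor_rel (ratfun_num r) (ratfun_den r) Q S.
Proof.
move=> sym E; split=> [z z0 _ qz|z].
  rewrite E; [|by rewrite /nonreal /= gt_eqF|exact: qz].
  by rewrite /ratfun_eval; field.
have [rz|nrz] := boolP (finite_pole r z).
  have rz' : finite_pole r (conjc z).
    apply/negPn/negP => h; have [] := sym _ h.
    by rewrite /= conjcK rz.
  by rewrite (eqP rz) (eqP rz') conjc0 !mulr0.
have [nrz' ] := sym _ nrz; rewrite /ratfun_eval conjcM.
have -> : conjc ((ratfun_den r).[z])^-1 = (conjc (ratfun_den r).[z])^-1 by exact: conjc_inv.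
move=> h.
have q1 : (ratfun_den r).[conjc z] != 0 by exact: nrz'.
have q2 : conjc (ratfun_den r).[z] != 0 by rewrite conjc_eq0; exact: nrz.
by apply/eqP; rewrite -eqr_div // h.
Qed.

Lemma ratfun_num_neq0 (r : ratfun R) : ratfun_nonconstant r -> ratfun_num r != 0.
Proof.
move=> nc; apply/eqP => p0; apply: nc; exists 0 => z _.
by rewrite /ratfun_eval p0 horner0 mul0r.
Qed.

End KacDonoghue.

Theorem proposition4p17 (R : realType) (r : ratfun R)
    (r_sym : ratfun_symmetric r) (r_nonconst : ratfun_nonconstant r)
    (Q0 : R[i] -> R[i]) (Q0_N00 : nevanlinna00 r Q0)
    (n1 n2 : nat) (a : 'I_n1 -> option R) (b : 'I_n2 -> option R)
    (a_zero : forall i, ratfun_zero r (a i))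
    (b_pole : forall i, ratfun_pole r (b i)) :
  (\bigcap_(i in [set: 'I_n2]) kac_donoghue (b i)) Q0 /\
  mul_in r Q0 (\bigcap_(i in [set: 'I_n1]) kac_donoghue (a i)).
Proof.
have [nQ [S nS E]] := Q0_N00.
have hQ := nevanlinna_pick nQ; have hS := nevanlinna_pick nS.
have rel := ratfun_factor_rel r_sym E.
have p0 := ratfun_num_neq0 r_nonconst; have q0 := ratfun_den_neq0 r.
have cop := ratfun_coprime r.
split; [|exists S => //]; move=> i _.
  case: (b i) (b_pole i) => [x rx|sz].
    by apply: kac_donoghue_finite => //; exact: finite_pole_bounded rel q0 cop rx.
  by apply: kac_donoghue_infinite => //; exact: infinite_pole_bounded rel p0 q0 sz.
have rel' := factor_rel_sym rel; rewrite coprimep_sym in cop.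
case: (a i) (a_zero i) => [x rx|sz].
  by apply: kac_donoghue_finite => //; exact: finite_pole_bounded rel' p0 cop rx.
by apply: kac_donoghue_infinite => //; exact: infinite_pole_bounded rel' q0 p0 sz.
Qed.
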